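(* Let $d\ge2$, $1\le i\le d-1$, $q\ge2$ an integer, $p\in[0,1]$, $p^*=\frac{(1-p)q}{(1-p)q+p}$, and let $\xi$ be a set of $i$-plaquettes of $\mathbb{Z}^d$ (boundary conditions). Let $\xi^{\bullet}$ be the set of $(d-i)$-plaquettes of $(\mathbb{Z}^d)^{\bullet}$ dual to $i$-plaquettes of $\mathbb{Z}^d$ not in $\xi$. Suppose the weak limit $$\mu^{\xi}_{\mathbb{Z}^d,p,q,i}:=\lim_{n\to\infty}\mu^{\xi}_{\Lambda_n,p,q,i}$$ exists. Then the weak limit $$\mu^{\overline{\xi^{\bullet}}}_{(\mathbb{Z}^d)^{\bullet},p^*,q,d-i}:=\lim_{n\to\infty}\mu^{\overline{\xi^{\bullet}}}_{\overline{\Lambda_n^{\bullet}},p^*,q,d-i}$$ also exists, and if $P$ is distributed according to $\mu^{\xi}_{\mathbb{Z}^d,p,q,i}$, then its dual complex $Q$ is distributed according to $\mu^{\overline{\xi^{\bullet}}}_{(\mathbb{Z}^d)^{\bullet},p^*,q,d-i}$.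
   Context: $\mathbb{Z}^d$ denotes the cubical complex on $\mathbb{R}^d$ whose $k$-cells are the $k$-dimensional unit cubes with integer corner points. For a subcomplex $X$, $X^{(k)}$ is the union of its cells of dimension at most $k$; $|X^{(i)}|$ denotes the number of $i$-cells ($i$-plaquettes) of $X$. An $i$-dimensional percolation subcomplex $P$ of $X$ is a subcomplex with $X^{(i-1)}\subset P\subset X^{(i)}$; $|P|$ is its number of $i$-plaquettes. It is identified with the configuration in $\{0,1\}^{\{i\text{-cells}\}}$ of its open plaquettes; weak convergence of measures on finite complexes exhausting $\mathbb{Z}^d$ means convergence of the probabilities of all events depending on finitely many plaquettes. Boxes: $\Lambda_n=[-n,n]^d$, viewed as a complex (for the given $i$), is the union of all cells of dimension at most $i-1$ contained in it and the $i$-cells contained in it that meet its interior. Duality: $(\mathbb{Z}^d)^{\bullet}=\mathbb{Z}^d+(1/2,\dots,1/2)$. Each $i$-cell of $\mathbb{Z}^d$ meets exactly one $(d-i)$-cell of $(\mathbb{Z}^d)^{\bullet}$, its dual. $\overline{\Lambda_n^{\bullet}}$ is the union of all cells of $(\mathbb{Z}^d)^{\bullet}$ of dimension at most $d-i$ contained in $[-n+\frac12,n-\frac12]^d$; its $(d-i)$-cells are exactly the duals of the $i$-plaquettes of $\Lambda_n$. The dual complex $Q$ of a percolation subcomplex $P$ of $\mathbb{Z}^d$ is the $(d-i)$-dimensional percolation subcomplex of $(\mathbb{Z}^d)^{\bullet}$ whose $(d-i)$-plaquettes are the duals of the $i$-plaquettes not in $P$. Measures with boundary conditions: for a finite subcomplex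 $X$ of $\mathbb{Z}^d$ and a set $\xi$ of $i$-plaquettes, put $P_\xi=P\cup\{\text{plaquettes of }\xi\text{ not in }X\}\cup(\mathbb{Z}^d)^{(i-1)}$ and let $\phi:P\to P_\xi$ be the inclusion. With $\phi^*:H^{i-1}(P_\xi;\mathbb{Z}_q)\to H^{i-1}(P;\mathbb{Z}_q)$, $\mathbb{Z}_q=\mathbb{Z}/q\mathbb{Z}$, the measure $\mu^{\xi}_{X,p,q,i}$ on $i$-dimensional percolation subcomplexes of $X$ is $$\mu^{\xi}_{X,p,q,i}(P)\propto p^{|P|}(1-p)^{|X^{(i)}|-|P|}\,|\mathrm{im}\,\phi^*|.$$ Borel--Moore homology $H_k^{\mathrm{BM}}(X;\mathbb{Z}_q)$ is the homology of the complex of locally finite chains ($C_k^{\mathrm{BM}}(X;\mathbb{Z}_q)$ consists of all formal, possibly infinite, sums $\sum_\sigma a_\sigma\sigma$ over $k$-cells of $X$, with the usual boundary operator). With $\phi_*^{\mathrm{BM}}:H_{i-1}^{\mathrm{BM}}(P;\mathbb{Z}_q)\to H_{i-1}^{\mathrm{BM}}(P_\xi;\mathbb{Z}_q)$, $$\mu^{\overline{\xi}}_{X,p,q,i}(P)\propto p^{|P|}(1-p)^{|X^{(i)}|-|P|}\,|\mathrm{im}\,\phi_*^{\mathrm{BM}}|.$$ The same definitions apply with $\mathbb{Z}^d$ replaced by $(\mathbb{Z}^d)^{\bullet}$ and $i$ by $d-i$. *)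

(* Defs.v *)
From HB Require Import structures.
From mathcomp Require Import all_boot all_order all_algebra finmap.
From mathcomp Require Import all_classical all_reals all_analysis.

Set Implicit Arguments.
Unset Strict Implicit.
Unset Printing Implicit Defensive.

Import Order.TTheory GRing.Theory Num.Theory numFieldNormedType.Exports.

Local Open Scope classical_set_scope.
Local Open Scope ring_scope.

(* A pair (x, I) stands for the unit cube with lowest corner x + (s, ..., s)
   and edge directions I, in the cubical complex on the shifted lattice
   (s, ..., s) + Z^d : s = 0 gives Z^d, s = 1/2 gives the dual (Z^d)^*.
   Incidences do not depend on s; only [cell_body] does. *)
Definition cell (d : nat) : Type := ({ffun 'I_d -> int} * {set 'I_d})%type.
Definition corner d (c : cell d) : {ffun 'I_d -> int} := c.1.
Definition dirs d (c : cell d) : {set 'I_d} := c.2.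
Definition dim d (c : cell d) : nat := #|dirs c|.

Definition kcell (d k : nat) : Type := {c : cell d | dim c == k}.

Definition cell_body (R : realType) d (s : R) (c : cell d) : set 'rV[R]_d :=
  [set y | forall j, (corner c j)%:~R + s <= y 0 j
                     <= (corner c j)%:~R + s + (j \in dirs c)%:R].

Section Algebra.
Variables (d q : nat).
Implicit Types (X Y P : set (cell d)) (s t : cell d).

Definition lower_face (j : 'I_d) s : cell d := (corner s, dirs s :\ j)%SET.
Definition upper_face (j : 'I_d) s : cell d :=
  ([ffun l => corner s l + (l == j)%:R], dirs s :\ j)%SET.

(* The coefficient of t in the boundary of s, for the product orientation. *)
Definition incidence s t : int :=
  \sum_(j in dirs s) (-1) ^+ #|[set l in dirs s | (l < j)%N]%SET| *
    ((t == upper_face j s)%:R - (t == lower_face j s)%:R).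

(* Chains and cochains are both functions on cells; (co)chains of a subcomplex
   are those vanishing off its k-cells. No finiteness is imposed on the
   support, so as chains these are the Borel-Moore (locally finite) ones.
   The sums below have finite support since Z^d is locally finite. *)
Definition chain : Type := cell d -> 'Z_q.

Definition chains_on X (k : nat) : set chain :=
  [set a | forall c, a c != 0 -> X c /\ dim c = k].

Definition restr X (f : chain) : chain := patch (fun=> 0) X f.

Definition bdry (a : chain) : chain :=
  fun t => \sum_(s \in [set: cell d]) (incidence s t)%:~R * a s.

Definition cobdry X (f : chain) : chain :=
  restr X (fun s => \sum_(t \in [set: cell d]) (incidence s t)%:~R * f t).

Definition cocycles X k : set chain :=
  [set f | chains_on X k f /\ cobdry X f = 0].

Definition coboundaries X k : set chain :=
  if k is m.+1 then cobdry X @` chains_on X m else [set 0].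

Definition cyclesBM X k : set chain :=
  [set a | chains_on X k a /\ bdry a = 0].

Definition boundariesBM X k : set chain := bdry @` chains_on X k.+1.

Definition chain_coset (B : set chain) (f : chain) : set chain :=
  [set f + b | b in B].

(* (Co)homology classes are cosets. *)
Definition cohomology X k : set (set chain) :=
  chain_coset (coboundaries X k) @` cocycles X k.

Definition homologyBM X k : set (set chain) :=
  chain_coset (boundariesBM X k) @` cyclesBM X k.

(* Maps induced by the inclusion of P in Y: the class of f goes to the class
   of f|P in cohomology, the class of a to the class of a in homology. *)
Definition coh_map P k (u : set chain) : set chain :=
  [set f | exists2 g, u g & chain_coset (coboundaries P k) (restr P g) f].

Definition homBM_map Y k (u : set chain) : set chain :=
  [set f | exists2 a, u a & chain_coset (boundariesBM Y k) a f].

Definition im_coh P Y k : set (set chain) :=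
  coh_map P k @` cohomology Y k.

Definition im_homBM P Y k : set (set chain) :=
  homBM_map Y k @` homologyBM P k.

Definition skeleton k X : set (cell d) := [set c | X c /\ (dim c <= k)%N].

End Algebra.

Arguments im_coh {d} q P Y k.
Arguments im_homBM {d} q P Y k.

Section Measures.
Variables (R : realType) (d : nat).
Implicit Types (X : set (cell d)) (k n : nat).

Definition plaquettes k X : {fset kcell d k} :=
  fset_set [set c : kcell d k | X (val c)].

(* The percolation subcomplex of X whose set of open k-plaquettes is A. *)
Definition perc_complex k X (A : {fset kcell d k}) : set (cell d) :=
  skeleton k.-1 X `|` [set val c | c in [set` A]].

Definition bc_complex k X (xi : set (kcell d k)) (A : {fset kcell d k}) :
    set (cell d) :=
  perc_complex X A `|` [set val c | c in [set c | xi c /\ ~ X (val c)]]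
  `|` skeleton k.-1 [set: cell d].

Definition bernoulli_weight (p : R) k X (A : {fset kcell d k}) : R :=
  p ^+ #|` A| * (1 - p) ^+ (#|` plaquettes k X| - #|` A|).

Definition weight_coh (p : R) (q k : nat) X (xi : set (kcell d k))
    (A : {fset kcell d k}) : R :=
  bernoulli_weight p X A *
  #|` fset_set (im_coh q (perc_complex X A) (bc_complex X xi A) k.-1)|%:R.

Definition weight_BM (p : R) (q k : nat) X (xi : set (kcell d k))
    (A : {fset kcell d k}) : R :=
  bernoulli_weight p X A *
  #|` fset_set (im_homBM q (perc_complex X A) (bc_complex X xi A) k.-1)|%:R.

(* {0,1}^{k-cells} with the product sigma-algebra. *)
Definition coordinate_events k : set (set (kcell d k -> bool)) :=
  [set [set w : kcell d k -> bool | w c] | c in [set: kcell d k]].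

Definition config k := g_sigma_algebraType (@coordinate_events k).

Definition config_of k (A : {fset kcell d k}) : config k := fun c => c \in A.

(* Probability of E under the measure on subsets of plaquettes of X that is
   proportional to w. *)
Definition gibbs k X (w : {fset kcell d k} -> R) (E : set (config k)) : R :=
  (\sum_(A <- fpowerset (plaquettes k X) | config_of A \in E) w A) /
  (\sum_(A <- fpowerset (plaquettes k X)) w A).

Definition mu_coh (p : R) (q k : nat) X (xi : set (kcell d k)) :
    set (config k) -> R :=
  gibbs X (weight_coh p q X xi).

Definition mu_BM (p : R) (q k : nat) X (xi : set (kcell d k)) :
    set (config k) -> R :=
  gibbs X (weight_BM p q X xi).

Definition finitely_determined k (E : set (config k)) : Prop :=
  exists F : {fset kcell d k}, forall w w' : config k,
    (forall c, c \in F -> w c = w' c) -> E w -> E w'.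

Definition weak_limit k (mun : nat -> set (config k) -> R)
    (mu : probability (config k) R) : Prop :=
  forall E : set (config k), finitely_determined E ->
    (fun n => (mun n E)%:E) @ \oo --> mu E.

Definition cube (r : R) : set 'rV[R]_d := [set y | forall j, - r <= y 0 j <= r].

Definition Lambda (i n : nat) : set (cell d) :=
  [set c | cell_body (0 : R) c `<=` cube n%:R /\
    ((dim c < i)%N \/
     dim c = i /\ cell_body (0 : R) c `&` (cube n%:R)° !=set0)].

Definition dual_Lambda (i n : nat) : set (cell d) :=
  [set c | cell_body (2^-1 : R) c `<=` cube (n%:R - 2^-1) /\
    (dim c <= d - i)%N].

(* c is an i-cell of Z^d, e a (d-i)-cell of the dual lattice. *)
Definition dual_cells i (c : kcell d i) (e : kcell d (d - i)) : Prop :=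
  cell_body (0 : R) (val c) `&` cell_body (2^-1 : R) (val e) !=set0.

Definition dual_plaquettes i (S : set (kcell d i)) : set (kcell d (d - i)) :=
  [set e | exists2 c, ~ S c & dual_cells c e].

Definition dual_config i (w : config i) : config (d - i) :=
  fun e => e \in dual_plaquettes [set c | w c].

Definition dual_param (p : R) (q : nat) : R :=
  ((1 - p) * q%:R) / ((1 - p) * q%:R + p).

End Measures.

Arguments mu_coh {R d} p q {k} X xi.
Arguments mu_BM {R d} p q {k} X xi.
Arguments Lambda R d i n : clear implicits.
Arguments dual_Lambda R d i n : clear implicits.
Arguments dual_plaquettes R {d i} S.
Arguments dual_config R {d i} w.

(* Main.v *)
From mathcomp Require Import all_boot all_order all_algebra finmap.
From mathcomp Require Import all_classical all_reals all_analysis.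
From mathcomp Require Import zify ring lra.
Require Import Defs.

(* Write i = k + 1 and let O be the set of open i-cells, namely A in the box
   together with xi outside. The image of H^k(P_xi) in H^k(P) has
   |R_O| / |B| elements, where R_O is the group of restrictions to the box of
   k-cochains f of Z^d with df = 0 on O, and B, the group of coboundaries of
   the box, does not depend on A. Dually, the image in Borel-Moore homology has
   |Z| / |W_O| elements, where Z is the group of (d-i-1)-cycles of the dual box
   and W_O is the subgroup of those that bound a (d-i)-chain vanishing on the
   duals of the cells of O.
   Opening one more cell c of the box divides |R_O| by the order of the group
   I = {df(c) : f in C^k(Z^d), df = 0 on O}, and divides |W_O| by
   |Z_q / I| : sending a boundary to the value at the dual of c of a chain it
   bounds maps W_O onto Z_q / I, with kernel W_{O + c}, because two such chains
   differ, by the Poincare lemma for infinite cochains, by the dual of some df.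
   So each opening divides |R_O| |W_O| by q, which is the factor relating p to
   p^*, and no homology of the boxes or of their complements is needed. *)

Set Implicit Arguments.
Unset Strict Implicit.
Unset Printing Implicit Defensive.

Import Order.TTheory GRing.Theory Num.Theory numFieldNormedType.Exports.

Local Open Scope classical_set_scope.
Local Open Scope ring_scope.

(** * Coboundaries and the Poincare lemma *)

Section Cochains.
Variables (d q : nat).
Implicit Types (s t u : cell d) (I J : {set 'I_d}) (f h : chain d q).

Lemma cellP s t :
  (forall l, corner s l = corner t l) -> dirs s = dirs t -> s = t.
Proof.
case: s t => [x I] [y J] /= xy ->; congr pair.
by apply/ffunP.
Qed.

Definition parity (j : 'I_d) I : nat := #|[set l in I | (l < j)%N]%SET|.

(** The coboundary on the whole lattice as a finite sum over directions; [cobdry] is its restriction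
    to a complex. *)
Definition cobd f s : 'Z_q :=
  \sum_(j in dirs s) (-1) ^+ parity j (dirs s) *
    (f (upper_face j s) - f (lower_face j s)).

Lemma cobdE f s :
  \sum_(t \in [set: cell d]) (incidence s t)%:~R * f t = cobd f s.
Proof.
(* The incidence with [s] vanishes off this list. All directions are listed, and for [j] outside
   [dirs s] the lower face is [s] itself, so duplicates occur and are removed. *)
pose r : seq (cell d) := undup ([seq upper_face j s | j <- enum 'I_d] ++
                      [seq lower_face j s | j <- enum 'I_d]).
have ur : uniq r by exact: undup_uniq.
have upr j : upper_face j s \in r.
  rewrite mem_undup mem_cat; apply/orP; left; apply/mapP; exists j => //.
  by rewrite mem_enum.
have lor j : lower_face j s \in r.
  rewrite mem_undup mem_cat; apply/orP; right; apply/mapP; exists j => //.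
  by rewrite mem_enum.
rewrite -(fsbig_widen [set` r] setT) //; last first.
  move=> t /= [_ tr]; rewrite /incidence big1 ?mul0r//= => j _.
  suff [/negPf -> /negPf ->] : t != upper_face j s /\ t != lower_face j s.
    by rewrite subrr mulr0.
  by split; apply: contra_notN tr => /eqP ->.
rewrite -fsbig_seq //.
have pick (t : cell d) : t \in r -> \sum_(u <- r) (u == t)%:R * f u = f t.
  move=> tr; rewrite (bigD1_seq t) //= eqxx mul1r big1 ?addr0// => u /negPf ->.
  by rewrite mul0r.
rewrite /incidence /cobd.
under eq_bigr => t _.
  rewrite rmorph_sum /= mulr_suml.
  under eq_bigr => j _.
    rewrite intrM rmorphXn /= rmorphB /= rmorphN1 !mulrz_nat.
    rewrite -mulrA mulrBl; over.
  over.
rewrite exchange_big /=; apply: eq_bigr => j _.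
by rewrite -mulr_sumr sumrB !pick.
Qed.

Lemma cobdryE Y f s : cobdry Y f s = if s \in Y then cobd f s else 0.
Proof. by rewrite /cobdry /restr /patch cobdE. Qed.

Lemma cobdB f h s : cobd (f - h) s = cobd f s - cobd h s.
Proof.
rewrite /cobd -sumrB; apply: eq_bigr => j _.
by rewrite -mulrBr; congr (_ * _); rewrite !fctE; ring.
Qed.

Lemma cobdD f h s : cobd (f + h) s = cobd f s + cobd h s.
Proof.
rewrite /cobd -big_split; apply: eq_bigr => j _.
by rewrite /= -mulrDr; congr (_ * _); rewrite !fctE; ring.
Qed.

Lemma dim_face j s : j \in dirs s -> (dim s = #|dirs s :\ j|.+1)%SET.
Proof. by move=> js; rewrite /dim (cardsD1 j) js add1n. Qed.

Lemma upper_faceC j l s :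
  upper_face j (upper_face l s) = upper_face l (upper_face j s).
Proof.
apply: cellP => [k|]; last by rewrite /= !finset.setDDl finset.setUC.
by rewrite !ffunE addrAC.
Qed.

Lemma lower_faceC j l s :
  lower_face j (lower_face l s) = lower_face l (lower_face j s).
Proof. by apply: cellP => [//|]; rewrite /= !finset.setDDl finset.setUC. Qed.

Lemma upper_lower_faceC j l s :
  upper_face j (lower_face l s) = lower_face l (upper_face j s).
Proof. by apply: cellP => [k|]; rewrite /= ?ffunE// !finset.setDDl finset.setUC. Qed.

Lemma sum_antisym (V : zmodType) (E : 'I_d -> 'I_d -> V) :
  (forall j, E j j = 0) -> (forall j l : 'I_d, (j < l)%N -> E j l = - E l j) ->
  \sum_j \sum_l E j l = 0.
Proof.
move=> E0 EN.
have -> : \sum_j \sum_l E j l =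
    \sum_(j < d) \sum_(l < d) (if (j < l)%N then E j l else 0) +
    \sum_(j < d) \sum_(l < d) (if (l < j)%N then E j l else 0).
  rewrite -big_split; apply: eq_bigr => j _; rewrite -big_split.
  apply: eq_bigr => l _ /=; case: (ltngtP j l) => [||/val_inj ->].
  - by rewrite addr0.
  - by rewrite add0r.
  - by rewrite E0 addr0.
rewrite [X in _ + X]exchange_big -big_split big1//= => j _.
rewrite -big_split big1// => l _ /=.
by case: ifP => [/EN ->|]; rewrite ?addNr ?addr0.
Qed.

Lemma parityD1 (j l : 'I_d) I : l \in I ->
  parity j I = ((l < j) + parity j (I :\ l)%SET)%N.
Proof.
move=> lI; rewrite /parity (cardsD1 l) !inE lI /=; congr (_ + _)%N.
by apply: eq_card => k; rewrite !inE andbA.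
Qed.

(** Removing two directions in either order leads to the same four cells, but removing the smaller
    direction first lowers the parity of the larger one by one. The terms therefore cancel in
    pairs. *)
Lemma cobd_cobd f s : cobd (cobd f) s = 0.
Proof.
pose D2 j l := f (upper_face l (upper_face j s)) - f (lower_face l (upper_face j s))
  - (f (upper_face l (lower_face j s)) - f (lower_face l (lower_face j s))).
have -> : cobd (cobd f) s = \sum_j \sum_l
    if [&& j \in dirs s, l \in dirs s & l != j] then
    (-1) ^+ (parity j (dirs s) + parity l (dirs s :\ j)%SET) * D2 j l else 0.
  rewrite /cobd big_mkcond; apply: eq_bigr => j _.
  case: (boolP (j \in dirs s)) => js /=; last by rewrite big1.
  rewrite -sumrB mulr_sumr big_mkcond; apply: eq_bigr => l _ /=.
  rewrite !inE andbC; case: ifP => // _.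
  by rewrite -mulrBr mulrA -exprD /D2.
apply: sum_antisym => [j|j l jl]; first by rewrite eqxx !andbF.
rewrite andbCA eq_sym; case: ifP; last by rewrite oppr0.
case/and3P => ls js lj; rewrite -mulNr; congr (_ * _).
  rewrite (parityD1 l js) jl (parityD1 j ls) ltnNge (ltnW jl).
  by rewrite add0n add1n addSn exprS mulN1r opprK addnC.
rewrite /D2 upper_faceC lower_faceC !upper_lower_faceC.
by rewrite !opprB !addrA; ring.
Qed.

Lemma cobd_supp k f : (forall t, f t != 0 -> dim t = k) ->
  forall s, cobd f s != 0 -> dim s = k.+1.
Proof.
move=> fk s; apply: contra_neq_eq => sk; rewrite /cobd big1 // => j js.
have f0 t : dirs t = (dirs s :\ j)%SET -> f t = 0.
  move=> ts; apply/eqP; apply: contraNT sk => /fk tk.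
  by rewrite (dim_face js) -ts -tk.
by rewrite !f0 // subrr mulr0.
Qed.

(** The antiderivative on the integers that vanishes at 0. It asks for no decay of [g], so cochains
    with infinite support can be integrated. *)
Definition prim (V : zmodType) (g : int -> V) (x : int) : V :=
  match x with
  | Posz n => \sum_(m < n) g m
  | Negz n => - \sum_(m < n.+1) g (Negz m)
  end.

Lemma primS (V : zmodType) (g : int -> V) x : prim g (x + 1) - prim g x = g x.
Proof.
case: x => [n|[|n]].
- rewrite /= addrC addn1 big_ord_recr /= addrA addNr add0r //.
- by rewrite /= big_ord0 big_ord1 opprK add0r.
- have -> : Negz n.+1 + 1 = Negz n by lia.
  by rewrite /= opprK addrC [in LHS]big_ord_recr /= addrAC subrr add0r.
Qed.

Lemma eq_prim (V : zmodType) (g g' : int -> V) : g =1 g' -> prim g =1 prim g'.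
Proof.
by move=> gg' [n|n] /=; [|congr (- _)]; apply: eq_bigr => j _; rewrite gg'.
Qed.

(* Directions are integrated out in increasing order, so that j is the least
   direction of every cell involved and its incidence sign is trivial. *)
Lemma poincare_step k h (j : 'I_d) :
    (forall s, h s != 0 -> dim s = k.+1) -> (forall s, cobd h s = 0) ->
    (forall s l, l \in dirs s -> (l < j)%N -> h s = 0) ->
  exists f, (forall t, f t != 0 -> dim t = k) /\
    forall s l, l \in dirs s -> (l <= j)%N -> cobd f s = h s.
Proof.
move=> hk hcl h0.
pose upd (x : {ffun 'I_d -> int}) (v : int) : {ffun 'I_d -> int} :=
  [ffun l => if l == j then v else x l].
pose low I := [exists l in I, (l <= j)%N].
(* [f] integrates [h] along direction [j], over the cells obtained from [t] by adding [j]. It is set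
   to zero on cells having a direction at most [j], so that a face which keeps such a direction
   contributes nothing. *)
pose f t := if low (dirs t) then 0 else
  prim (fun v => h (upd (corner t) v, (j |: dirs t)%SET)) (corner t j).
have f0 (l : 'I_d) t : l \in dirs t -> (l <= j)%N -> f t = 0.
  move=> lt lj; rewrite /f /low ifT //; apply/fintype.existsP.
  by exists l; rewrite lt.
exists f; split.
  move=> t; rewrite /f; case: ifPn => [|lowt]; first by rewrite eqxx.
  have jt : j \notin dirs t.
    apply: contra lowt => jt; rewrite /low; apply/fintype.existsP; exists j.
    by rewrite jt leqnn.
  apply: contra_neq_eq => tk.
  have hz v : h (upd (corner t) v, (j |: dirs t)%SET) = 0.
    apply/eqP; apply: contraNT tk => /hk; rewrite /dim /= cardsU1 jt.
    by move=> /eqP; rewrite add1n eqSS.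
  rewrite (eq_prim hz); case: (corner t j) => m /=; rewrite big1 ?oppr0//.
move=> s l ls; rewrite leq_eqVlt => /orP[/eqP/val_inj lj|lj].
  subst l; rewrite /cobd (bigD1 j) //= [X in _ + X]big1 ?addr0; last first.
    move=> l /andP[ls' lj]; rewrite !(f0 j) ?leqnn ?subrr ?mulr0 //=.
      by rewrite !inE ls eq_sym lj.
    by rewrite !inE ls eq_sym lj.
  have [/fintype.existsP[m /andP[ms mj]]|nolow] :=
      boolP [exists m in dirs s, (m < j)%N].
    rewrite (h0 s m) // !(f0 m) ?subrr ?mulr0// ?(ltnW mj) //=.
      by rewrite !inE ms -(inj_eq val_inj) /= ltn_eqF.
    by rewrite !inE ms -(inj_eq val_inj) /= ltn_eqF.
  have -> : parity j (dirs s) = 0%N.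
    apply: eq_card0 => m; rewrite !inE; apply: contraNF nolow => mm.
    by apply/fintype.existsP; exists m.
  have nl : low (dirs s :\ j)%SET = false.
    apply: contraNF nolow => /fintype.existsP[m].
    rewrite !inE => /andP[/andP[mj ms] ml].
    apply/fintype.existsP; exists m; rewrite ms ltn_neqAle ml andbT.
    by rewrite (inj_eq val_inj).
  rewrite expr0 mul1r /f /= nl ffunE eqxx.
  have -> : (j |: dirs s :\ j)%SET = dirs s by rewrite finset.setD1K.
  rewrite (@eq_prim _ _ (fun v => h (upd (corner s) v, dirs s))); last first.
    move=> v; congr (h (_, _)); apply/ffunP => m; rewrite !ffunE.
    by case: (m =P j) => _; [|exact: addr0].

  rewrite primS; congr h; apply: cellP => //= m; rewrite ffunE.
  by case: eqP => // ->.
(* Now [l] is below [j], so [h s] vanishes and [cobd f s] must vanish too. If [s] has another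
   direction at most [j], every face keeps a low direction; otherwise only the two faces in
   direction [l] count. *)
rewrite (h0 s l) //.
have [/fintype.existsP[m /and3P[ms mj ml]]|nolow] :=
    boolP [exists m, [&& m \in dirs s, (m <= j)%N & m != l]].
  rewrite /cobd big1// => l' _; have [ml'|ml'] := eqVneq m l'.
    rewrite !(f0 l) ?subrr ?mulr0 ?(ltnW lj)//= !inE ls ?andbT -ml' eq_sym//.
  by rewrite !(f0 m) ?subrr ?mulr0 //= !inE ms ml'.
rewrite /cobd (bigD1 l) //= [X in _ + X]big1 ?addr0; last first.
  move=> m /andP[ms ml]; rewrite !(f0 l) ?(ltnW lj) ?subrr ?mulr0//=;
  by rewrite !inE ls eq_sym ml.
have nl : low (dirs s :\ l)%SET = false.
  apply: contraNF nolow => /fintype.existsP[m].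
  rewrite !inE => /andP[/andP[ml ms] mj].
  by apply/fintype.existsP; exists m; rewrite ms ml mj.
have js : j \notin dirs s.
  apply: contra nolow => js; apply/fintype.existsP; exists j.
  by rewrite js leqnn -(inj_eq val_inj) /= gtn_eqF.
have jl : j != l by rewrite -(inj_eq val_inj) /= gtn_eqF.
rewrite /f /= nl ffunE (negPf jl) addr0.
suff E v : h (upd [ffun m => corner s m + (m == l)%:R] v, (j |: dirs s :\ l)%SET) =
           h (upd (corner s) v, (j |: dirs s :\ l)%SET).
  by rewrite (eq_prim E) subrr mulr0.
(* The faces of [c] in directions other than [l] keep [l], so [h] is zero on them, and closedness of
   [h] at [c] equates its values on the two faces in direction [l]. *)
pose c : cell d := (upd (corner s) v, (j |: dirs s)%SET).
have lc : l \in dirs c by rewrite !inE ls orbT.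
have clc : (j |: dirs s :\ l)%SET = (dirs c :\ l)%SET.
  by rewrite /c /= finset.setDUl; congr (_ :|: _)%SET; apply/setP => m;
    rewrite !inE; apply/idP/idP => [/eqP ->|/andP[]//]; rewrite jl eqxx.
have := hcl c; rewrite /cobd (bigD1 l) //= [X in _ + X]big1 ?addr0; last first.
  move=> m /andP[mc ml]; rewrite !(h0 _ l) ?lj ?subrr ?mulr0//= in_setD1 lc eq_sym;
  by rewrite ml.
move=> /(congr1 (fun z => (-1) ^+ parity l (dirs c) * z)).
rewrite mulrA -exprD addnn -mul2n exprM sqrrN expr1n expr1n mul1r mulr0.
move=> /eqP; rewrite subr_eq0 => /eqP.
rewrite /lower_face /upper_face -clc /= => <-; congr (h (_, _)).
apply/ffunP => m; rewrite !ffunE; case: eqP => // ->.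
by rewrite (negPf jl) addr0.
Qed.

(** The directions are integrated one after another: once those below [m] are done, the remainder
    [h - cobd f] is still closed and vanishes on every cell with a direction below [m], as
    [poincare_step] requires. *)
Lemma poincare k h :
    (forall s, h s != 0 -> dim s = k.+1) -> (forall s, cobd h s = 0) ->
  exists f, (forall t, f t != 0 -> dim t = k) /\ forall s, cobd f s = h s.
Proof.
move=> hk hcl.
have : forall m, (m <= d)%N -> exists f, (forall t, f t != 0 -> dim t = k) /\
    forall s (l : 'I_d), l \in dirs s -> (l < m)%N -> cobd f s = h s.
  elim=> [|m IH] md; first by exists 0; split => // t; rewrite eqxx.
  have [f [fk fh]] := IH (ltnW md).
  have hfk s : (h - cobd f) s != 0 -> dim s = k.+1.
    apply: contra_neq_eq => sk; rewrite !fctE.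
    have -> : h s = 0 by apply/eqP; apply: contraNT sk => /hk ->.
    have -> : cobd f s = 0.
      by apply/eqP; apply: contraNT sk => /(cobd_supp fk) ->.
    by rewrite subrr.
  have hfc s : cobd (h - cobd f) s = 0 by rewrite cobdB hcl cobd_cobd subrr.
  have [|g [gk gh]] := @poincare_step k (h - cobd f) (Ordinal md) hfk hfc.
    by move=> s l ls lm; rewrite !fctE (fh s l) // subrr.
  exists (f + g); split=> [t|s l ls lm].
    have [/fk //|f0] := boolP (f t != 0); rewrite !fctE.
    by move: f0; rewrite negbK => /eqP ->; rewrite add0r => /gk.
  have gs := gh s l ls lm.
  by rewrite cobdD gs -[(h - cobd f) s]/(h s - cobd f s) addrC subrK.
move=> /(_ d (leqnn d))[f [fk fh]]; exists f; split=> // s.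
have [s0|[l ls]] := set_0Vmem (dirs s); last exact: (fh s l).
have ds : dim s = 0%N by rewrite /dim s0 cards0.
have -> : h s = 0 by apply/eqP; apply: contraT => /hk; rewrite ds.
by rewrite /cobd s0 big_set0.
Qed.

End Cochains.

(** * Dual cells and boundaries *)

Section Duality.
Variables (d q : nat).
Implicit Types (s t u e : cell d) (I J : {set 'I_d}) (f h a b : chain d q).

(** The cell with the same centre and complementary directions, in the coordinates of the lattice
    shifted by 1/2. In a direction absent from [s] the dual edge starts at [x - 1/2], which has
    index [x - 1]. *)
Definition dualc s : cell d :=
  ([ffun l => corner s l - (l \notin dirs s)%:R], ~: dirs s)%SET.

Definition undualc e : cell d :=
  ([ffun l => corner e l + (l \in dirs e)%:R], ~: dirs e)%SET.

Lemma dualcK : cancel dualc undualc.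
Proof.
move=> s; apply: cellP => [l|]; last by rewrite /= finset.setCK.
by rewrite !ffunE inE subrK.
Qed.

Lemma undualcK : cancel undualc dualc.
Proof.
move=> s; apply: cellP => [l|]; last by rewrite /= finset.setCK.
by rewrite !ffunE inE negbK addrK.
Qed.

Lemma dim_dualc s : dim (dualc s) = (d - dim s)%N.
Proof. by rewrite /dim /= cardsCs finset.setCK card_ord. Qed.

Lemma dim_undualc e : dim (undualc e) = (d - dim e)%N.
Proof. by rewrite /dim /= cardsCs finset.setCK card_ord. Qed.

Lemma dim_le s : (dim s <= d)%N.
Proof. by rewrite /dim -[X in (_ <= X)%N]card_ord max_card. Qed.

(* The sign under which duality carries cobd to the opposite of bdry. *)
Definition csign s : int := (-1) ^+ \sum_(l in dirs s) (l : nat).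

Lemma csign_sq s : csign s * csign s = 1.
Proof. by rewrite -expr2 sqrr_sign. Qed.

(** Dual cells share their centres, and the centre of [s] is half a step above that of its lower
    face in direction [j]. Hence duality reverses the face relation and exchanges upper and lower
    faces. *)
Lemma lower_dual j s t : j \in dirs s -> j \notin dirs t ->
  (t == lower_face j s) = (dualc s == upper_face j (dualc t)).
Proof.
move=> js jt; apply/eqP/eqP => [->|st].
  apply: cellP => [l|]; last first.
    by apply/setP => l; rewrite !inE; case: eqVneq => [->|]; rewrite ?js.
  rewrite !ffunE !inE; case: eqVneq => [->|] /=; last by rewrite addr0.
  by rewrite js subr0 subrK.
apply: cellP => [l|].
  have := congr1 (fun u => corner u l) st; rewrite /= !ffunE.
  have := congr1 (fun u => l \in dirs u) st; rewrite /= !inE.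
  have [-> _|lj /= ->] := eqVneq l j; first by rewrite js jt subr0 subrK.
  by rewrite addr0 => /addIr.
have := congr1 (@dirs d) st; rewrite /= => e; apply/setP => l.
have := congr1 (fun I : {set 'I_d} => l \in I) e; rewrite !inE.
case: eqVneq => [-> _|_ /=]; first exact: negbTE.
by move=> /negb_inj.
Qed.

Lemma upper_dual j s t : j \in dirs s -> j \notin dirs t ->
  (t == upper_face j s) = (dualc s == lower_face j (dualc t)).
Proof.
move=> js jt; apply/eqP/eqP => [->|st].
  apply: cellP => [l|]; last first.
    by apply/setP => l; rewrite !inE; case: eqVneq => [->|]; rewrite ?js.
  rewrite !ffunE !inE; case: eqVneq => [->|] /=; last by rewrite addr0.
  by rewrite js subr0 addrK.
apply: cellP => [l|].
  have := congr1 (fun u => corner u l) st; rewrite /= !ffunE.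
  have := congr1 (fun u => l \in dirs u) st; rewrite /= !inE.
  have [-> _|lj /= ->] := eqVneq l j.
    by rewrite js jt subr0 => ->; rewrite subrK.
  by rewrite addr0 => /addIr.
have := congr1 (@dirs d) st; rewrite /= => e; apply/setP => l.
have := congr1 (fun I : {set 'I_d} => l \in I) e; rewrite !inE.
case: eqVneq => [-> _|_ /=]; first exact: negbTE.
by move=> /negb_inj.
Qed.

(** Each of the [j] directions below [j] lies either in [dirs s] or in the complement of [dirs t],
    so the two parities add up to [j], while [csign s] and [csign t] differ by the factor
    [(-1) ^+ j]. *)
Lemma parity_compl j s t : j \in dirs s -> dirs t = (dirs s :\ j)%SET ->
  (-1) ^+ parity j (~: dirs t) =
    csign s * csign t * (-1) ^+ parity j (dirs s) :> int.
Proof.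
move=> js ts.
have -> : csign s = (-1) ^+ j * csign t.
  by rewrite /csign -exprD (big_setD1 j) //= ts.
rewrite mulrC -mulrA csign_sq mulr1.
have pc : (parity j (~: dirs t) + parity j (dirs s) = j)%N.
  rewrite /parity -cardsUI [X in (_ + X)%N](_ : _ = 0%N) ?addn0; last first.
    apply: eq_card0 => l; rewrite !inE ts !inE.
    case: eqVneq => [->|_ /=]; rewrite ?ltnn ?andbF //.
    by case: (l \in dirs s); rewrite ?andbF.
  have winj : injective (widen_ord (ltnW (ltn_ord j))).
    by move=> x y /(congr1 val) /= /val_inj.
  rewrite -[RHS](card_ord j) -(card_imset predT winj).
  apply: eq_card => l; rewrite !inE ts !inE.
  apply/idP/imsetP => [|[m _ ->]] /=; last first.
    rewrite ltn_ord; have [mj|] := eqVneq (widen_ord _ m) j.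
      move/(congr1 val): mj (ltn_ord m) => /= mj.
      by rewrite [X in (X < _)%N]mj ltnn.
    by case: (_ \in dirs s).
  move=> lj; have {}lj : (l < j)%N by case: (l < j)%N lj; rewrite ?andbF.
  by exists (Ordinal lj) => //; apply: val_inj.
by rewrite -[in RHS]pc exprD mulrCA -expr2 sqrr_sign mulr1.
Qed.

(** The product of the [csign] factors comes from [parity_compl], the minus sign from the exchange
    of upper and lower faces. *)
Lemma incidence_dual s t :
  incidence (dualc t) (dualc s) = - (csign s * csign t * incidence s t).
Proof.
rewrite /incidence mulr_sumr -sumrN big_mkcond [RHS]big_mkcond /=.
apply: eq_bigr => j _; rewrite inE.
case: (boolP (j \in dirs s)) => js; last first.
  case: (boolP (j \in dirs t)) => jt //=.
  suff [/negPf -> /negPf ->] : dualc s != upper_face j (dualc t) /\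
      dualc s != lower_face j (dualc t) by rewrite subrr mulr0.
  by split; apply: contra js => /eqP /(congr1 (fun u => j \in dirs u));
    rewrite /= !inE eqxx /= => /negbFE.
case: (boolP (j \in dirs t)) => jt /=.
  suff [/negPf -> /negPf ->] : t != upper_face j s /\ t != lower_face j s.
    by rewrite subrr !mulr0 oppr0.
  by split; apply: contraL jt => /eqP ->; rewrite !inE eqxx.
rewrite -upper_dual // -lower_dual //.
have [ts|ts] := eqVneq (dirs t) (dirs s :\ j)%SET.
  by rewrite (parity_compl js ts); ring.
suff [/negPf -> /negPf ->] : t != upper_face j s /\ t != lower_face j s.
  by rewrite subrr !mulr0 oppr0.
by split; apply: contra ts => /eqP ->.
Qed.

(** Reads a locally finite chain of the dual lattice as a cochain, turning boundaries into
    coboundaries up to sign; [dual_chain] is the inverse. *)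
Definition codual a : chain d q := fun u => (csign u)%:~R * a (dualc u).

Lemma csign_sqr s : (csign s)%:~R * (csign s)%:~R = 1 :> 'Z_q.
Proof. by rewrite -intrM csign_sq. Qed.

Lemma cobdZ (c : 'Z_q) f s : cobd (fun t => c * f t) s = c * cobd f s.
Proof.
by rewrite /cobd mulr_sumr; apply: eq_bigr => j _; rewrite -mulrBr mulrCA.
Qed.

Lemma bdryE a s : bdry a (dualc s) = - (csign s)%:~R * cobd (codual a) s.
Proof.
have dualc_bij : bijective dualc.
  by exists undualc; [exact: dualcK|exact: undualcK].
rewrite /bdry (reindex_fsbigT _ _ dualc_bij) -cobdZ -cobdE.
apply: eq_fsbigr => u _; rewrite incidence_dual /codual.
by rewrite rmorphN /= !intrM; ring.
Qed.

Lemma codualB a b : codual (a - b) = codual a - codual b.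
Proof. by apply/funext => u; rewrite /codual !fctE mulrBr. Qed.

Lemma bdryB a b : bdry (a - b) = bdry a - bdry b.
Proof.
apply/funext => e; rewrite !fctE -(undualcK e) !bdryE codualB cobdB.
by rewrite mulrBr.
Qed.

Lemma codual_bdry a s : codual (bdry a) s = - cobd (codual a) s.
Proof. by rewrite /codual bdryE mulrA mulrN csign_sqr mulN1r. Qed.

Lemma bdry_bdry a : bdry (bdry a) = 0.
Proof.
apply/funext => e; rewrite -(undualcK e) bdryE.
have -> : codual (bdry a) = 0 - cobd (codual a).
  by apply/funext => s; rewrite codual_bdry !fctE sub0r.
rewrite cobdB cobd_cobd subr0 /cobd big1 ?mulr0// => j _.
by rewrite subrr mulr0.
Qed.

Definition dual_chain f : chain d q :=
  fun e => (csign (undualc e))%:~R * f (undualc e).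

Lemma dual_chainK f : codual (dual_chain f) = f.
Proof.
by apply/funext => u; rewrite /codual /dual_chain dualcK mulrA csign_sqr mul1r.
Qed.

Lemma codualK a : dual_chain (codual a) = a.
Proof.
by apply/funext => u; rewrite /codual /dual_chain undualcK mulrA csign_sqr mul1r.
Qed.

Lemma bdry_dual_chain f : bdry (dual_chain (cobd f)) = 0.
Proof.
by apply/funext => e; rewrite -(undualcK e) bdryE dual_chainK cobd_cobd mulr0.
Qed.

(** Through [codual] this is the Poincare lemma: Borel-Moore homology of the lattice vanishes below
    the top degree. The bound on [k] keeps the natural subtraction exact. *)
Lemma bdry0_exact k a : (k < d)%N ->
    (forall e, a e != 0 -> dim e = (d - k.+1)%N) -> bdry a = 0 ->
  exists f, (forall t, f t != 0 -> dim t = k) /\ a = dual_chain (cobd f).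
Proof.
move=> kd ak a0.
have ck s : codual a s != 0 -> dim s = k.+1.
  rewrite /codual => as0; have /ak : a (dualc s) != 0.
    by apply: contra_neq as0 => ->; rewrite mulr0.
  by rewrite dim_dualc; have := dim_le s; lia.
have c0 s : cobd (codual a) s = 0.
  by apply/eqP; rewrite -oppr_eq0 -codual_bdry a0 /codual mulr0.
have [f [fk fa]] := poincare ck c0; exists f; split=> //.
by rewrite -[LHS]codualK; congr dual_chain; apply/funext => s.
Qed.

Lemma incidence_face s t : incidence s t != 0 ->
  exists2 j, j \in dirs s & t = upper_face j s \/ t = lower_face j s.
Proof.
apply: contra_neqP => nf; rewrite /incidence big1// => j js.
suff [/negPf -> /negPf ->] : t != upper_face j s /\ t != lower_face j s.
  by rewrite subrr mulr0.
by split; apply: contra_notN nf => /eqP ->; exists j; auto.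
Qed.

Lemma bdry_delta e (z : 'Z_q) t :
  bdry (fun u => if u == e then z else 0) t = (incidence e t)%:~R * z.
Proof.
rewrite /bdry -(fsbig_widen [set e] setT) //.
  by rewrite fsbig_set1 eqxx.
by move=> u /= [_ /eqP/negPf ->]; rewrite mulr0.
Qed.

End Duality.

(** * Effect of opening a cell *)

(** Each nonempty fibre of [f] on [S] is a translate of [S] intersected with [K]. The values of [f]
    lie in a bare type, so that they can be cosets as well as scalars. *)
Lemma card_fibration (V : zmodType) (T : choiceType) (S K : set V) (f : V -> T) :
    finite_set S -> S 0 -> (forall x y, S x -> S y -> S (x - y)) ->
    (forall x y, S x -> S y -> (f x = f y <-> K (x - y))) ->
  #|` fset_set S| = (#|` fset_set (f @` S)| * #|` fset_set (S `&` K)|)%N.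
Proof.
move=> Sf S0 SB fK.
have SD x y : S x -> S y -> S (x + y).
  by move=> Sx Sy; rewrite -[y]opprK -[- y]sub0r; apply/SB/SB.
rewrite card_fset_sum1 (partition_big_imfset _ f) /= fset_set_image //.
rewrite [in RHS]card_fset_sum1 big_distrl /=; apply: eq_big_seq => y.
move=> /imfsetP[/= x0]; rewrite in_fset_set // inE => Sx0 ->.
rewrite mul1n big_fset_condE -card_fset_sum1.
have SKf : finite_set (S `&` K) by exact: finite_setIl.
have -> : #|` fset_set (S `&` K)| =
    #|` [fset (x0 + z)%R | z in fset_set (S `&` K)]%fset|.
  by rewrite card_imfset //; exact: addrI.
congr (#|` _|).
have memE x : (x \in [fset i in fset_set S | f i == f x0]%fset) =
    (x \in S) && (f x == f x0) by rewrite !inE -(in_fset_set Sf).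
apply/fsetP => x; apply/idP/imfsetP => /=.
  rewrite memE => /andP[/set_mem Sx /eqP fx].
  exists (x - x0); last by rewrite addrC subrK.
  by rewrite in_fset_set // inE; split; [exact: SB|apply/fK].
move=> [z]; rewrite in_fset_set // inE => -[Sz Kz] ->.
rewrite memE; apply/andP; split; first exact/mem_set/SD.
by apply/eqP/fK => //; [exact: SD|rewrite addrC addKr].
Qed.

Lemma card_fset_setT (T : finType) : #|` fset_set [set: T]| = #|T|.
Proof.
have -> : fset_set [set: T] = [fset x in predT]%fset.
  by apply/fsetP => x; rewrite in_fset_set ?in_setT ?inE //; exact: finite_finset.
by rewrite card_imfset // cardE.
Qed.

Lemma card_Zq q : (1 < q)%N -> #|` fset_set [set: 'Z_q]| = q.
Proof. by move=> q1; rewrite card_fset_setT card_ord Zp_cast. Qed.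

Lemma fset_set_gt0 (T : choiceType) (S : set T) x :
  finite_set S -> S x -> (0 < #|` fset_set S|)%N.
Proof.
move=> Sf Sx; rewrite cardfs_gt0; apply/fset0Pn; exists x.
by rewrite in_fset_set // inE.
Qed.

Section Counting.
Variables (d q : nat).
Implicit Types (s t u c e : cell d) (f g h a b w : chain d q).

Lemma finite_chains (X : set (cell d)) k :
  finite_set X -> finite_set (@chains_on d q X k).
Proof.
move=> /finite_fsetP[F XF].
pose ext (g : {ffun F -> 'Z_q}) : chain d q :=
  fun c => if insub c is Some u then g u else 0.
apply: (sub_finite_set _ (finite_image ext (@finite_finset _ [set: {ffun F -> 'Z_q}]))).
move=> f fX; exists [ffun u => f (val u)] => //.
apply/funext => c; rewrite /ext; case: insubP => [u cF uc|cF].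
  by rewrite ffunE uc.
apply/esym/eqP; apply: contraNT cF => /fX[Xc _].
by move: Xc; rewrite XF.
Qed.

Lemma chains_onB X k a b : chains_on X k a -> chains_on X k b ->
  chains_on X k (a - b).
Proof.
move=> aX bX c; have [/aX //|] := boolP (a c != 0).
have [/bX //|] := boolP (b c != 0).
by rewrite !negbK => /eqP b0 /eqP a0; rewrite !fctE a0 b0 subrr eqxx.
Qed.

Lemma chains_on0 X k : chains_on X k (0 : chain d q).
Proof. by move=> c; rewrite eqxx. Qed.

(* O is the set of open cells, of dimension k.+1. Zopen is the group of
   k-cocycles of P_xi and Ropen its restriction to the box L; Copen is the group
   of chains of the dual Q_xi (carried by the duals of the closed cells) and
   Wopen consists of their boundaries that are m-cycles of the dual box L'. *)
Definition Zopen k (O : set (cell d)) : set (chain d q) :=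
  [set f | chains_on setT k f /\ forall c, O c -> cobd f c = 0].

Definition Ropen k (L O : set (cell d)) : set (chain d q) :=
  restr L @` Zopen k O.

Definition Copen k (O : set (cell d)) : set (chain d q) :=
  [set a | chains_on setT (d - k.+1) a /\ forall c, O c -> a (dualc c) = 0].

Definition Wopen k m (L' O : set (cell d)) : set (chain d q) :=
  cyclesBM L' m `&` @bdry d q @` Copen k O.

Definition faces_in (X : set (cell d)) c :=
  forall j, j \in dirs c -> X (upper_face j c) /\ X (lower_face j c).

Lemma cobd_restr L f c : faces_in L c -> cobd (restr L f) c = cobd f c.
Proof.
move=> cL; apply: eq_bigr => j /cL[Lu Ll].
by rewrite /restr /patch !mem_set.
Qed.

Lemma restrB L f g : restr L (f - g) = restr L f - restr L g.
Proof.
apply/funext => c; rewrite !fctE /restr /patch; case: ifP => //.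
by rewrite subrr.
Qed.

Lemma cobd0 c : cobd (0 : chain d q) c = 0.
Proof. by rewrite /cobd big1 // => j _; rewrite subrr mulr0. Qed.

Lemma bdry0 : bdry (0 : chain d q) = 0.
Proof. by rewrite -[0 in LHS](subrr 0) bdryB subrr. Qed.

Lemma Zopen0 k O : Zopen k O 0.
Proof. by split=> [|c _]; [exact: chains_on0|exact: cobd0]. Qed.

Lemma ZopenB k O f g : Zopen k O f -> Zopen k O g -> Zopen k O (f - g).
Proof.
move=> [f1 f2] [g1 g2]; split=> [|c Oc]; first exact: chains_onB.
by rewrite cobdB f2 // g2 // subrr.
Qed.

Lemma ZopenZ k O f z : Zopen k O f -> Zopen k O (fun c => z * f c).
Proof.
move=> [f1 f2]; split=> [c|c Oc]; last by rewrite cobdZ f2 // mulr0.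
by move=> zf; apply: f1; apply: contra_neq zf => ->; rewrite mulr0.
Qed.

Lemma Copen0 k O : Copen k O 0.
Proof. by split=> //; exact: chains_on0. Qed.

Lemma CopenB k O a b : Copen k O a -> Copen k O b -> Copen k O (a - b).
Proof.
move=> [f1 f2] [g1 g2]; split=> [|c Oc]; first exact: chains_onB.
by rewrite !fctE f2 // g2 // subrr.
Qed.

Lemma restr_chains_on X L k f :
  chains_on X k f -> chains_on (X `&` L) k (restr L f).
Proof.
move=> fX c; rewrite /restr /patch; case: ifPn => [|_]; last by rewrite eqxx.
by rewrite inE => Lc /fX[Xc dc].
Qed.

Lemma finite_Ropen k L O : finite_set L -> finite_set (Ropen k L O).
Proof.
move=> Lf; apply: (sub_finite_set _ (finite_chains k Lf)).
by move=> _ [f [fk _] <-] c /(restr_chains_on fk)[[_ Lc] dc].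
Qed.

Lemma finite_cyclesBM m (L' : set (cell d)) :
  finite_set L' -> finite_set (@cyclesBM d q L' m).
Proof.
move=> Lf; apply: (sub_finite_set _ (finite_chains m Lf)).
by move=> f [].
Qed.

Lemma cyclesBM0 L' m : @cyclesBM d q L' m 0.
Proof. by split; [exact: chains_on0|exact: bdry0]. Qed.

Lemma cyclesBMB L' m a b :
  @cyclesBM d q L' m a -> cyclesBM L' m b -> cyclesBM L' m (a - b).
Proof.
move=> [a1 a2] [b1 b2]; split; first exact: chains_onB.
by rewrite bdryB a2 b2 subrr.
Qed.

Lemma Wopen0 k m L' O : Wopen k m L' O 0.
Proof.
split; first exact: cyclesBM0.
by exists 0; [exact: Copen0|exact: bdry0].
Qed.

Lemma WopenB k m L' O a b :
  Wopen k m L' O a -> Wopen k m L' O b -> Wopen k m L' O (a - b).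
Proof.
move=> [a1 [a' a2 a3]] [b1 [b' b2 b3]]; split; first exact: cyclesBMB.
by exists (a' - b'); [exact: CopenB|rewrite bdryB a3 b3].
Qed.

Lemma delta_Copen k O c (z : 'Z_q) : dim c = k.+1 -> ~ O c ->
  Copen k O (fun u => if u == dualc c then z else 0).
Proof.
move=> dc nOc; split=> [u|u Ou].
  by have [->|_] := eqVneq u (dualc c); rewrite ?eqxx // dim_dualc dc.
case: eqVneq => // /(can_inj (@dualcK d)) uc; by rewrite uc in Ou.
Qed.

Lemma card_Ropen_Wopen_open_cell k m L L' O c : (1 < q)%N ->
    finite_set L -> finite_set L' -> (d - k.+1 = m.+1)%N ->
    dim c = k.+1 -> ~ O c -> faces_in L c -> faces_in L' (dualc c) ->
  (#|` fset_set (Ropen k L O)| * #|` fset_set (Wopen k m L' O)| =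
   q * (#|` fset_set (Ropen k L (O `|` [set c]))| *
        #|` fset_set (Wopen k m L' (O `|` [set c]))|))%N.
Proof.
move=> q1 Lf L'f dkm dc nOc cL cL'.
have kd : (k < d)%N by lia.
(* The ideal of the values at [c] of coboundaries that vanish on the open cells. *)
pose I : set 'Z_q := [set cobd f c | f in Zopen k O].
have IB x y : I x -> I y -> I (x - y).
  move=> [f Zf <-] [g Zg <-]; exists (f - g); first exact: ZopenB.
  by rewrite cobdB.
have IZ z x : I x -> I (z * x).
  move=> [f Zf <-]; exists (fun c => z * f c); first exact: ZopenZ.
  by rewrite cobdZ.
have I0 : I 0 by exists 0; [exact: Zopen0|exact: cobd0].
(* [kappa] is the quotient map of ['Z_q] by [I]. [theta w] collects the values at the dual of [c] of
   all admissible chains bounding [w], so no such chain has to be chosen. *)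
pose kappa (z : 'Z_q) : set 'Z_q := [set y | I (y - z)].
pose theta w : set 'Z_q :=
  [set a (dualc c) | a in Copen k O `&` [set a | bdry a = w]].
(* Two chains with equal boundary differ by the dual of some [cobd f], where [f] is a cocycle on the
   open cells; conversely, subtracting such a dual preserves the boundary and moves the value at the
   dual of [c] by any element of [I]. *)
have thetaE a : Copen k O a -> theta (bdry a) = kappa (a (dualc c)).
  move=> Ca; apply/seteqP; split=> [_ [b [Cb /= ba] <-]|y] /=.
    have [||f [fk fE]] := @bdry0_exact d q k (b - a) kd.
    - by move=> e; case: (CopenB Cb Ca) => /(_ e) + _ => /[apply] -[].
    - by rewrite bdryB ba subrr.
    have fb u : cobd f u = (csign u)%:~R * (b - a) (dualc u).
      by rewrite fE /dual_chain dualcK mulrA csign_sqr mul1r.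
    have Zf : Zopen k O f.
      split=> [t /fk //|u Ou]; rewrite fb.
      by case: (CopenB Cb Ca) => _ ->; rewrite ?mulr0.
    rewrite /kappa /=.
    have -> : b (dualc c) - a (dualc c) = (csign c)%:~R * cobd f c.
      by rewrite fb mulrA csign_sqr mul1r.
    by apply: IZ; exists f.
  move=> /(IZ (- (csign c)%:~R))[f [fk fO] fc].
  exists (a - dual_chain (cobd f)); last first.
    rewrite !fctE /dual_chain dualcK fc mulrA mulrN csign_sqr mulN1r opprB.
    by rewrite subKr.
  split; last by rewrite /= bdryB bdry_dual_chain subr0.
  apply: CopenB => //; split=> [e|u Ou]; last first.
    by rewrite /dual_chain dualcK fO // mulr0.
  rewrite /dual_chain => fe; split=> //.
  have fe0 : cobd f (undualc e) != 0 by apply: contra_neq fe => ->; rewrite mulr0.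
  have fk' t : f t != 0 -> dim t = k by move=> /fk[].
  by have := cobd_supp fk' fe0; rewrite dim_undualc; have := dim_le e; lia.
(* Evaluating the coboundary at [c] makes sense on restrictions because the faces of [c] lie in the
   box; its image is [I], and its kernel consists of the cochains compatible with [c] open. *)
have HR : #|` fset_set (Ropen k L O)| =
    (#|` fset_set I| * #|` fset_set (Ropen k L (O `|` [set c]))|)%N.
  rewrite (@card_fibration _ _ _ [set g | cobd g c = 0] (fun g => cobd g c)).
  - congr (_ * _)%N; congr (#|` fset_set _|).
      apply/seteqP; split=> [_ [_ [f Zf <-] <-]|_ [f Zf <-]].
        by exists f; rewrite ?cobd_restr.
      by exists (restr L f); [exists f|rewrite cobd_restr].
    apply/seteqP; split=> [_ [[f [fk fO] <-] /=]|_ [f [fk fO] <-]].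
      rewrite cobd_restr // => fc; exists f => //; split=> // u [/fO //|].
      by move=> ->.
    split; first by exists f => //; split=> // u Ou; apply: fO; left.
    by rewrite /= cobd_restr // fO //; right.
  - exact: finite_Ropen.
  - exists 0; first exact: Zopen0.
    by rewrite -[0 in LHS](subrr 0) restrB subrr.
  - move=> _ _ [f Zf <-] [g Zg <-]; rewrite -restrB.
    by exists (f - g) => //; exact: ZopenB.
  - by move=> x y _ _; rewrite /= cobdB; split=> [->|/subr0_eq//]; rewrite subrr.
have Hq : q = (#|` fset_set (kappa @` setT)| * #|` fset_set I|)%N.
  rewrite -[LHS](card_Zq q1) (@card_fibration _ _ _ I kappa) ?setTI //;
    first exact: finite_finset.
  move=> x y _ _; split=> [xy|Ixy].
    have : kappa x x by rewrite /kappa /= subrr.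
    by rewrite xy.
  apply/seteqP; split=> z; rewrite /kappa /= => Iz.
    have -> : z - y = (z - x) - (- (x - y)) by ring.
    by apply: (IB) => //; rewrite -sub0r; exact: IB.
  have -> : z - x = (z - y) - (x - y) by ring.
  exact: IB.
have HW : #|` fset_set (Wopen k m L' O)| = (#|` fset_set (kappa @` setT)| *
    #|` fset_set (Wopen k m L' (O `|` [set c]))|)%N.
  rewrite (@card_fibration _ _ _ (Wopen k m L' (O `|` [set c])) theta).
  - congr (_ * _)%N; congr (#|` fset_set _|).
      apply/seteqP; split=> [_ [_ [_ [a Ca <-]] <-]|_ [z _ <-]].
        by rewrite thetaE //; exists (a (dualc c)).
      (* Every class is attained: the boundary of a multiple of the single dual cell of [c] is a
         cycle of the dual box, because the faces of that cell lie there. *)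
      pose e := fun u : cell d => if u == dualc c then z else 0.
      have Ce : Copen k O e by exact: delta_Copen.
      exists (bdry e); last by rewrite thetaE // /e eqxx.
      split; last by exists e.
      split; last exact: bdry_bdry.
      move=> t; rewrite bdry_delta => te.
      have /incidence_face[j jc tj] : incidence (dualc c) t != 0.
        by apply: contra_neq te => ->; rewrite mul0r.
      have [Lu Ll] := cL' j jc; split; first by case: tj => ->.
      apply/eqP; rewrite -eqSS -dkm -dc -dim_dualc (dim_face jc).
      by case: tj => ->.
    apply/seteqP; split=> [w [//]|w Ww]; split=> //.
    case: Ww => Zw [a [ak aO] aw]; split=> //; exists a => //.
    by split=> // u Ou; apply: aO; left.
  - exact: finite_setIl (finite_cyclesBM _ _).
  - exact: Wopen0.
  - exact: WopenB.
  - move=> x y [Zx [a Ca ax]] [Zy [b Cb b_y]]; split=> [|[Zxy [e [ek eO] exy]]].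
      rewrite -[in X in X = _]ax thetaE // => tE.
      have : theta y (a (dualc c)) by rewrite -tE /kappa /= subrr.
      (* [b'] bounds [y] and takes the same value as [a] at the dual of [c]; hence [a - b'] vanishes
         there and witnesses that [x - y] survives the opening of [c]. *)
      move=> [b' [Cb' b'y] b'a]; split; first exact: cyclesBMB.
      exists (a - b'); last by rewrite bdryB ax b'y.
      case: (CopenB Ca Cb') => abk abO; split=> // u [/abO//|->].
      by rewrite !fctE b'a subrr.
    have Ce : Copen k O e by split=> // u Ou; apply: eO; left.
    have ec : e (dualc c) = 0 by apply: eO; right.
    rewrite -ax thetaE // -b_y thetaE //.
    have : bdry (a - e) = bdry b by rewrite bdryB exy ax b_y opprB addrC subrK.
    have CB : Copen k O (a - e) by exact: CopenB.
    move=> /(congr1 theta); rewrite !thetaE // => <-.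
    by rewrite !fctE ec subr0.
by rewrite HR HW mulnACA [X in (X * _)%N]mulnC -Hq.
Qed.

End Counting.

Arguments Zopen {d} q k O _.
Arguments Ropen {d} q k L O _.
Arguments Copen {d} q k O _.
Arguments Wopen {d} q k m L' O _.

(** * Images in cohomology and Borel-Moore homology as quotients *)

Section Images.
Variables (d q : nat).
Implicit Types (s t u c e : cell d) (f g h a b w : chain d q).
Implicit Types (X Y P L : set (cell d)).

Definition subgroup (B : set (chain d q)) :=
  B 0 /\ forall x y, B x -> B y -> B (x - y).

Lemma subgroupD B x y : subgroup B -> B x -> B y -> B (x + y).
Proof.
by move=> [B0 BB] Bx By; rewrite -[y]opprK -[- y]sub0r; apply/BB => //; apply: BB.
Qed.

Lemma chain_coset_eq B x y : subgroup B ->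
  chain_coset B x = chain_coset B y <-> B (x - y).
Proof.
move=> Bg; have [B0 BB] := Bg; split=> [xy|Bxy].
  have : chain_coset B x x by exists 0 => //; rewrite addr0.
  by rewrite xy => -[b Bb <-]; rewrite addrC addKr.
apply/seteqP; split=> _ [b Bb <-].
  by exists (x - y + b); [exact: subgroupD|rewrite addrA [y + _]addrC subrK].
exists (b - (x - y)); first exact: BB.
by rewrite opprB addrCA [x + _]addrC subrK addrC.
Qed.

(** The kernel is written [S] intersected with [B], since the boundaries of the large complex,
    divided out in homology, may leave the box. *)
Lemma card_cosets (S B : set (chain d q)) :
  finite_set S -> subgroup S -> subgroup B ->
  #|` fset_set S| = (#|` fset_set (chain_coset B @` S)| *
                     #|` fset_set (S `&` B)|)%N.
Proof.
move=> Sf [S0 SB] Bg; apply: card_fibration => // x y _ _.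
exact: chain_coset_eq.
Qed.

Lemma chains_on_eq X Y k f : (forall c, dim c = k -> X c <-> Y c) ->
  chains_on X k f -> chains_on Y k f.
Proof. by move=> XY fX c /fX[Xc dc]; split=> //; apply/XY. Qed.

Lemma restr_eq X Y k f : (forall c, dim c = k -> X c <-> Y c) ->
  (forall c, f c != 0 -> dim c = k) -> restr X f = restr Y f.
Proof.
move=> XY fk; apply/funext => c; rewrite /restr /patch.
have [/fk/XY XYc|] := boolP (f c != 0).
  by rewrite (_ : (c \in X) = (c \in Y)) //; apply/idP/idP; rewrite !inE => /XYc.
by rewrite negbK => /eqP ->; rewrite !if_same.
Qed.

Lemma cobdry_restr X f : cobdry X f = restr X (cobd f).
Proof. by apply/funext => s; rewrite cobdryE. Qed.

(** Applied to a percolation complex and its box, this makes the group of coboundaries independent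
    of the open plaquettes. *)
Lemma coboundaries_eq X Y k : (forall c, (dim c <= k)%N -> X c <-> Y c) ->
  @coboundaries d q X k = coboundaries Y k.
Proof.
move=> XY; suff sub X' Y' : (forall c, (dim c <= k)%N -> X' c <-> Y' c) ->
    @coboundaries d q X' k `<=` coboundaries Y' k.
  by apply/seteqP; split; apply: sub => // c /XY; apply: iff_sym.
case: k {XY} => [_ //|k XY _ [f fX <-]]; exists f.
  by apply: (chains_on_eq _ fX) => c dc; apply: XY; rewrite dc.
rewrite !cobdry_restr; apply/esym/(@restr_eq _ _ k.+1).
  by move=> c dc; apply: XY; rewrite dc.
by move=> c; apply: cobd_supp => t /fX[].
Qed.

Lemma subgroup_coboundaries X k : subgroup (@coboundaries d q X k).
Proof.
case: k => [|k]; first by split=> //= x y -> ->; rewrite subrr.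
split=> [|_ _ [f fX <-] [g gX <-]].
  exists 0; first exact: chains_on0.
  by rewrite cobdry_restr; apply/funext => s; rewrite /restr /patch cobd0 if_same.
exists (f - g); first exact: chains_onB.
rewrite !cobdry_restr -restrB; congr restr.
by apply/funext => s; rewrite cobdB.
Qed.

Definition face_closed k L :=
  forall c, (dim c <= k)%N -> L c -> faces_in L c.

(** Makes restriction well defined on cohomology classes. A cell of [P] of dimension at most [k] has
    its faces in [P], so there the coboundary commutes with restriction. *)
Lemma restr_coboundaries P Y k : P `<=` Y -> face_closed k P ->
  forall b, coboundaries Y k b -> @coboundaries d q P k (restr P b).
Proof.
case: k => [|k] PY Pcl b /=.
  by move=> ->; apply/funext => c; rewrite /restr /patch if_same.
move=> [g gY <-]; exists (restr P g).
  by apply: (chains_on_eq _ (restr_chains_on gY)) => c _; split=> [[]|/[dup] /PY].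
rewrite !cobdry_restr; apply/funext => s; rewrite /restr /patch.
case: ifPn => // sP; rewrite (mem_set (PY _ (set_mem sP))).
have [ds|ds] := eqVneq (dim s) k.+1.
  by rewrite cobd_restr //; apply: Pcl; rewrite ?ds //; exact/set_mem.
have z h : (forall t, h t != 0 -> dim t = k) -> cobd h s = 0.
  by move=> hk; apply/eqP; apply: contraNT ds => /(cobd_supp hk) ->.
rewrite !z // => t; first by move=> /gY[].
by move=> /(restr_chains_on gY)[].
Qed.

Lemma image_image_eq (T1 T2 T3 : Type) (S : set T1) (f : T1 -> T2) (g : T2 -> T3)
  (h : T1 -> T3) : (forall x, S x -> g (f x) = h x) -> g @` (f @` S) = h @` S.
Proof.
move=> gf; apply/seteqP; split=> [_ [_ [x Sx <-] <-]|_ [x Sx <-]].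
  by exists x; rewrite ?gf.
by exists (f x); [exists x|rewrite gf].
Qed.

(** The union of the classes of the restrictions of the members of one class is a single class, so
    the induced map can be computed on representatives. *)
Lemma im_cohE P Y k : P `<=` Y -> face_closed k P ->
  im_coh q P Y k = chain_coset (coboundaries P k) @` (restr P @` cocycles Y k).
Proof.
move=> PY Pcl; rewrite /im_coh /cohomology.
have mapE f : coh_map P k (chain_coset (coboundaries Y k) f) =
    chain_coset (@coboundaries d q P k) (restr P f).
  have BPg := subgroup_coboundaries P k.
  apply/seteqP; split=> [h [_ [b Bb <-]] [b' Bb' <-]|h fh].
    exists (restr P b + b').
      by apply: subgroupD => //; exact: (restr_coboundaries PY Pcl Bb).
    rewrite addrA; congr (_ + _); apply/funext => c; rewrite /= !fctE /restr /patch.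
    by case: ifP => //; rewrite addr0.
  exists f => //; exists 0; last by rewrite addr0.
  by case: (subgroup_coboundaries Y k).
by rewrite (image_image_eq (h := chain_coset (coboundaries P k) \o restr P))
  ?image_comp.
Qed.

Lemma subgroup_bdry (S : set (chain d q)) : subgroup S -> subgroup (@bdry d q @` S).
Proof.
move=> [S0 SB]; split=> [|_ _ [a Sa <-] [b Sb <-]].
  by exists 0 => //; exact: bdry0.
by exists (a - b); [exact: SB|rewrite bdryB].
Qed.

Lemma im_homBME P Y k : P `<=` Y ->
  im_homBM q P Y k = chain_coset (boundariesBM Y k) @` cyclesBM P k.
Proof.
move=> PY; rewrite /im_homBM /homologyBM; apply: image_image_eq => a _.
have Yg : subgroup (@boundariesBM d q Y k).
  by apply: subgroup_bdry; split; [exact: chains_on0|exact: chains_onB].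
have Pg : subgroup (@boundariesBM d q P k).
  by apply: subgroup_bdry; split; [exact: chains_on0|exact: chains_onB].
apply/seteqP; split=> [h [_ [b Bb <-]] [b' Bb' <-]|h ah].
  exists (b + b'); last by rewrite addrA.
  apply: subgroupD => //; case: Bb => g gP <-; exists g => //.
  by move=> c /gP[/PY].
by exists a => //; exists 0; rewrite ?addr0 //; case: Pg.
Qed.

Lemma val_dim k (c : kcell d k) : dim (val c) = k.
Proof. exact/eqP/(valP c). Qed.

Definition open_cells k L (xi : set (kcell d k)) (A : {fset kcell d k}) :
    set (cell d) :=
  [set val c | c in [set c | c \in A \/ xi c /\ ~ L (val c)]].

Lemma perc_complex_lt k L (A : {fset kcell d k.+1}) c : (dim c <= k)%N ->
  perc_complex L A c <-> L c.
Proof.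
move=> dc; split=> [[[]//|[e _ ec]]|Lc]; last by left.
by move: dc; rewrite -ec val_dim ltnn.
Qed.

(** A coboundary of the box is the restriction of a coboundary of the whole lattice, which is a
    cocycle whatever cells are open. *)
Lemma coboundaries_Ropen k L O : @coboundaries d q L k `<=` Ropen q k L O.
Proof.
case: k => [_ ->|k _ [g gL <-]].
  exists 0; first exact: Zopen0.
  by rewrite -[0 in LHS](subrr 0) restrB subrr.
exists (cobd g); last by rewrite cobdry_restr.
split=> [c gc|c _]; last exact: cobd_cobd.
by split=> //; apply: cobd_supp gc => t /gL[].
Qed.

(** The complex with boundary condition contains all [k]-cells of the lattice, and its [k.+1]-cells
    are exactly the open ones, so its cocycles are [Zopen]. The image is then [Ropen] modulo the
    coboundaries of the box. *)
Lemma card_im_coh k L (xi : set (kcell d k.+1)) (A : {fset kcell d k.+1}) :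
    finite_set L -> face_closed k L ->
  #|` fset_set (Ropen q k L (open_cells L xi A))| =
  (#|` fset_set (im_coh q (perc_complex L A) (bc_complex L xi A) k)| *
   #|` fset_set (@coboundaries d q L k)|)%N.
Proof.
move=> Lf Lcl; set P := perc_complex L A; set Y := bc_complex L xi A.
have PY : P `<=` Y by move=> c Pc; left; left.
have PL c : (dim c <= k)%N -> P c <-> L c by exact: perc_complex_lt.
have Pcl : face_closed k P.
  move=> c dc /(PL c dc)/(Lcl c dc) Lc j jc; have [Lu Ll] := Lc j jc.
  have dj : (#|dirs c :\ j|%SET <= k)%N by move: dc; rewrite (dim_face jc) => /ltnW.
  by split; apply/PL.
have ZY : cocycles Y k = Zopen q k (open_cells L xi A).
  apply/seteqP; split=> [f [fY f0]|f [fT f0]]; split.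
  - by move=> c /fY[].
  - move=> c Oc; have := congr1 (fun g => g c) f0.
    rewrite cobdry_restr /restr /patch ifT //; apply/mem_set.
    case: Oc => e [eA|[exi eL]] <-.
      by left; left; right; exists e.
    by left; right; exists e.
  - by move=> c /fT[_ dc]; split=> //; right; split; rewrite ?dc.
  - rewrite cobdry_restr; apply/funext => s; rewrite /restr /patch.
    case: ifPn => // /set_mem Ys.
    have [ds|ds] := eqVneq (dim s) k.+1; last first.
      have fk t : f t != 0 -> dim t = k by move=> /fT[].
      by apply/eqP; apply: contraNT ds => /(cobd_supp fk) ->.
    apply: f0; case: Ys => [[[[_]|[e eA <-]]|[e [e1 e2] <-]]|[_]].
    + by rewrite ds ltnn.
    + by exists e => //; left.
    + by exists e => //; right.
    + by rewrite ds ltnn.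
have BP : @coboundaries d q P k = coboundaries L k by exact: coboundaries_eq.
have RP : restr P @` cocycles Y k = Ropen q k L (open_cells L xi A).
  have PLr f : Zopen q k (open_cells L xi A) f -> restr P f = restr L f.
    move=> [fT _]; apply: (@restr_eq _ _ k) => c; last by move=> /fT[].
    by move=> dc; apply: PL; rewrite dc.
  by rewrite ZY; apply/seteqP; split=> _ [f Zf <-]; exists f; rewrite ?PLr.
rewrite im_cohE // RP -BP.
rewrite (card_cosets _ _ (subgroup_coboundaries P k)); first last.
- split.
    exists 0; first exact: Zopen0.
    by rewrite -[0 in LHS](subrr 0) restrB subrr.
  move=> _ _ [f Zf <-] [g Zg <-]; rewrite -restrB.
  by exists (f - g) => //; exact: ZopenB.
- exact: finite_Ropen.
congr (_ * _)%N; congr (#|` fset_set _|).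
apply/seteqP; split=> [b []//|b Bb]; split=> //.
by apply: coboundaries_Ropen; rewrite -BP.
Qed.

(** The percolation complex and the box have the same [m]-cells, hence the same [m]-cycles, and the
    boundaries in the large complex are those of the chains in [Copen]. The cycles that die in
    homology therefore form [Wopen]. *)
Lemma card_im_homBM k m L' O (xi' : set (kcell d (d - k.+1)))
    (A' : {fset kcell d (d - k.+1)}) :
    (d - k.+1 = m.+1)%N -> finite_set L' ->
    (forall c, dim c = k.+1 ->
       (bc_complex L' xi' A' (dualc c) <-> ~ O c)) ->
  #|` fset_set (@cyclesBM d q L' m)| =
  (#|` fset_set (im_homBM q (perc_complex L' A') (bc_complex L' xi' A') m)| *
   #|` fset_set (Wopen q k m L' O)|)%N.
Proof.
move=> dkm L'f YO.
set P := perc_complex L' A'; set Y := bc_complex L' xi' A' in YO *.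
have PY : P `<=` Y by move=> c Pc; left; left.
have PL c : (dim c <= m)%N -> P c <-> L' c.
  move=> dc; split=> [[[]//|[e _ ec]]|Lc].
    by have := val_dim e; rewrite ec dkm => ec'; rewrite ec' ltnn in dc.
  by left; split=> //; rewrite dkm.
have ZP : @cyclesBM d q P m = cyclesBM L' m.
  apply/seteqP; split=> a [aP a0]; split=> //; apply: (chains_on_eq _ aP) => c dc.
    by apply: PL; rewrite dc.
  by apply: iff_sym; apply: PL; rewrite dc.
have BY : @boundariesBM d q Y m = @bdry d q @` Copen q k O.
  rewrite /boundariesBM -dkm; congr (_ @` _); apply/seteqP; split=> a.
    move=> aY; split=> [e /aY[]//|c Oc].
    apply/eqP; apply: contraPT Oc => /aY[Yc dc].
    apply/YO => //; move: dc; rewrite dim_dualc; have := dim_le c; lia.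
  move=> [aT aO] e ae; have [_ de] := aT e ae; split=> //.
  rewrite -(undualcK e); apply/YO; first by rewrite dim_undualc de; lia.
  by move=> /aO; rewrite undualcK => e0; rewrite e0 eqxx in ae.
have BYg : subgroup (@boundariesBM d q Y m).
  by apply: subgroup_bdry; split; [exact: chains_on0|exact: chains_onB].
rewrite im_homBME // ZP (card_cosets _ _ BYg).
- by rewrite /Wopen BY.
- exact: finite_cyclesBM.
- by split; [exact: cyclesBM0|exact: cyclesBMB].
Qed.

(** Induction on the number of closed plaquettes of the box, opened one at a time at the price of a
    factor [q]; the fully open box is the reference. *)
Lemma card_Ropen_Wopen k m L L' (xi : set (kcell d k.+1)) :
    (1 < q)%N -> (d - k.+1 = m.+1)%N -> finite_set L -> finite_set L' ->
    (forall c, L c -> dim c = k.+1 -> faces_in L c /\ faces_in L' (dualc c)) ->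
  forall A, (A `<=` plaquettes k.+1 L)%fset ->
  (#|` fset_set (Ropen q k L (open_cells L xi A))| *
   #|` fset_set (Wopen q k m L' (open_cells L xi A))| =
   q ^ (#|` plaquettes k.+1 L| - #|` A|) *
   (#|` fset_set (Ropen q k L (open_cells L xi (plaquettes k.+1 L)))| *
    #|` fset_set (Wopen q k m L' (open_cells L xi (plaquettes k.+1 L)))|))%N.
Proof.
move=> q1 dkm Lf L'f LL' A; set F := plaquettes k.+1 L.
move: {2}(_ - _)%N (erefl (#|` F| - #|` A|)%N) => n.
have Ff : finite_set [set c : kcell d k.+1 | L (val c)].
  exact: (finite_preimage (in2W val_inj)).
elim: n A => [|n IH] A nA AF.
  have -> : A = F.
    by apply/eqP; rewrite eqEfcard AF; have := fsubset_leq_card AF; lia.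
  by rewrite subnn expn0 mul1n.
have /fset0Pn[c] : (F `\` A)%fset != fset0.
  by rewrite -cardfs_gt0 cardfsDS // nA.
rewrite inE => /andP[cA cF].
have Lc : L (val c) by move: cF; rewrite in_fset_set // inE.
have [cL cL'] := LL' _ Lc (val_dim c).
have OA : open_cells L xi A `|` [set val c] = open_cells L xi (c |` A)%fset.
  apply/seteqP; split=> [_ [[e [eA|exi] <-]|->]|_ [e [ec|exi] <-]].
  - by exists e => //; left; rewrite !inE eA orbT.
  - by exists e => //; right.
  - by exists c => //; left; rewrite !inE eqxx.
  - move: ec; rewrite !inE => /orP[/eqP ->|eA]; first by right.
    by left; exists e => //; left.
  - by left; exists e => //; right.
have cA1 : #|` (c |` A)%fset| = #|` A|.+1 by rewrite cardfsU1 cA.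
have cAF : (c |` A `<=` F)%fset by rewrite fsubUset fsub1set cF.
have cF1 := fsubset_leq_card cAF.
have nO : ~ open_cells L xi A (val c).
  move=> [e [eA|[_ eL]] /val_inj ec]; first by rewrite -ec eA in cA.
  by rewrite ec in eL.
rewrite (card_Ropen_Wopen_open_cell q1 Lf L'f dkm (val_dim c) nO cL cL').
rewrite OA IH //; last by rewrite cA1; lia.
by rewrite cA1 mulnA -expnS; congr (_ ^ _ * _)%N; lia.
Qed.

End Images.

(** * Boxes and dual plaquettes *)

Section Boxes.
Variables (R : realType) (d : nat).
Implicit Types (c e : cell d) (i n : nat) (s r : R).

Lemma cell_body_sub_cube s r c : cell_body s c `<=` cube r <->
  forall j, - r <= (corner c j)%:~R + s /\
    (corner c j)%:~R + s + (j \in dirs c)%:R <= r.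
Proof.
split=> [cr j|cr y yc j]; last first.
  have [cl cu] := cr j; have /andP[yl yu] := yc j.
  by apply/andP; split; [exact: le_trans cl yl|exact: le_trans yu cu].
pose lo : 'rV[R]_d := \row_j ((corner c j)%:~R + s).
pose hi : 'rV[R]_d := \row_j ((corner c j)%:~R + s + (j \in dirs c)%:R).
have loc : cell_body s c lo by move=> l; rewrite mxE lexx lerDl ler0n.
have hic : cell_body s c hi by move=> l; rewrite mxE lexx lerDl ler0n.
have := cr _ loc j; have := cr _ hic j; rewrite /= !mxE.
by move=> /andP[_ ->] /andP[-> _].
Qed.

Lemma ler_natz (n : nat) (x : int) : (x%:~R <= n%:R :> R) = (x <= n%:Z).
Proof. by rewrite -[n%:R]/(n%:Z%:~R) ler_int. Qed.

Lemma lerN_natz (n : nat) (x : int) : (- n%:R <= x%:~R :> R) = (- n%:Z <= x).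
Proof. by rewrite -[n%:R]/(n%:Z%:~R) -rmorphN /= ler_int. Qed.

Lemma interior_cube r (y : 'rV[R]_d) (eps : R) : 0 < eps ->
  (forall j, - r + eps <= y 0 j <= r - eps) -> (cube r)° y.
Proof.
move=> e0 yr; apply/nbhs_ballP; exists eps => //= z [_ yz] j.
have := yz 0 j; rewrite /ball /= ltr_distl => /andP[z1 z2].
have /andP[y1 y2] := yr j; apply/andP; lra.
Qed.

Lemma interior_cube_lt r (y : 'rV[R]_d) j : (cube r)° y -> - r < y 0 j < r.
Proof.
move=> /nbhs_ballP[eps /= e0 yr].
have yz t : `|t| < eps -> cube r (\row_l (y 0 l + (l == j)%:R * t)).
  move=> te; apply: yr; split=> // a l; rewrite ord1 mxE /ball /=.
  rewrite opprD addNKr normrN; case: (l == j); first by rewrite mul1r.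
  by rewrite mul0r normr0.
have h0 : 0 < eps / 2 by rewrite divr_gt0.
have h1 : eps / 2 < eps by lra.
have := yz (eps / 2); rewrite gtr0_norm // => /(_ h1 j).
have := yz (- (eps / 2)); rewrite normrN gtr0_norm // => /(_ h1 j).
rewrite !mxE eqxx !mul1r => /andP[a1 a2] /andP[b1 b2].
apply/andP; lra.
Qed.

Lemma LambdaE i n c : Lambda R d i n c <->
  [/\ (dim c <= i)%N,
      forall j, - n%:Z <= corner c j /\ corner c j + (j \in dirs c)%:R <= n%:Z &
      dim c = i -> forall j, j \notin dirs c -> - n%:Z < corner c j < n%:Z].
Proof.
have subE : cell_body (0 : R) c `<=` cube n%:R <->
    forall j, - n%:Z <= corner c j /\ corner c j + (j \in dirs c)%:R <= n%:Z.
  rewrite cell_body_sub_cube; split=> cr j; have := cr j;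
  by rewrite addr0 -[(_ \in _)%:R in X in X <= n%:R]/((j \in dirs c)%:Z%:~R)
    -intrD ler_natz lerN_natz natz.
have natZ (b : bool) : b%:R = b%:Z by case: b.
split=> [[/subE cr dc]|[ci cr cint]].
  split=> //; first by case: dc => [/ltnW|[->]].
  move=> di j jc; case: dc => [|[_ [y [yc yn]]]]; first by rewrite di ltnn.
  have := interior_cube_lt j yn; have := yc j.
  rewrite (negPf jc) !addr0 -eq_le => /eqP <-.
  by rewrite -[n%:R]/(n%:Z%:~R) -rmorphN /= !ltr_int.
split; first exact/subE.
move: ci; rewrite leq_eqVlt => /orP[/eqP di|]; [right; split=> //|by left].
(* The centre of the cell is at distance at least 1/2 from the boundary of the cube. *)
exists (\row_j ((corner c j)%:~R + (j \in dirs c)%:R / 2)); split.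
  move=> j; rewrite mxE addr0; case: (j \in dirs c) => /=; apply/andP; lra.
apply: (@interior_cube _ _ 2^-1) => [|j]; first by rewrite invr_gt0.
rewrite mxE.
have [cl cu] := cr j; have := cint di j.
case: (boolP (j \in dirs c)) cl cu => jc /=.
  rewrite -(ler_int R) -[_ + _ <= _](ler_int R) rmorphD rmorphN /= => cl cu _.
  by apply/andP; lra.
move=> _ _ /(_ isT)/andP[cl cu].
have {}cl : - n%:Z + 1 <= corner c j by lia.
have {}cu : corner c j + 1 <= n%:Z by lia.
move: cl cu; rewrite -(ler_int R) -[_ + _ <= _](ler_int R) !rmorphD rmorphN /=.
by move=> cl cu; apply/andP; lra.
Qed.

(** The [+ 1] gathers the shift of the lattice by 1/2 and the 1/2 by which the cube is shrunk. *)
Lemma dual_LambdaE i n e : dual_Lambda R d i n e <->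
  (dim e <= d - i)%N /\
  forall j, - n%:Z <= corner e j /\ corner e j + 1 + (j \in dirs e)%:R <= n%:Z.
Proof.
have subE : cell_body (2^-1 : R) e `<=` cube (n%:R - 2^-1) <->
    forall j, - n%:Z <= corner e j /\ corner e j + 1 + (j \in dirs e)%:R <= n%:Z.
  rewrite cell_body_sub_cube; split=> er j; have := er j;
  rewrite -(ler_int R) -[_ + _ <= n%:Z](ler_int R) !rmorphD rmorphN /=;
  by case: (j \in dirs e) => -[h1 h2]; split; move: h1 h2 => /=; lra.
by split=> [[/subE]|[de /subE]].
Qed.

(** In a direction of [c] both conditions agree. In any other direction the dual edge from [x - 1/2]
    to [x + 1/2] fits in the shrunken cube exactly when [-n < x < n], which is the condition that
    [c] meet the interior. *)
Lemma dual_Lambda_dualc i n c : (i <= d)%N -> dim c = i ->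
  dual_Lambda R d i n (dualc c) <-> Lambda R d i n c.
Proof.
move=> id di; split.
  move=> /dual_LambdaE[_ cr]; apply/LambdaE; split=> [|j|_ j jc]; first by rewrite di.
    have := cr j; rewrite /= !ffunE inE.
    by case: (j \in dirs c) => /=; lia.
  by have := cr j; rewrite /= !ffunE inE jc /=; lia.
move=> /LambdaE[_ cr cint]; apply/dual_LambdaE; split=> [|j].
  by rewrite dim_dualc di.
have := cr j; have := cint di j; rewrite /= !ffunE inE.
by case: (j \in dirs c) => /= [_|/(_ isT)]; lia.
Qed.

(** Proper faces have dimension below [i], where no interior condition is imposed. *)
Lemma Lambda_faces i n c : Lambda R d i n c -> faces_in (Lambda R d i n) c.
Proof.
move=> /LambdaE[di cr _] j jc.
have dj : (#|dirs c :\ j|%SET < i)%N by rewrite -(dim_face jc).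
have nu : dim (upper_face j c) != i by rewrite neq_ltn; apply/orP; left; exact: dj.
have nl : dim (lower_face j c) != i by rewrite neq_ltn; apply/orP; left; exact: dj.
split; apply/LambdaE; split=> [||/eqP]; rewrite ?(negPf nu) ?(negPf nl) //;
  try exact: ltnW.
  move=> l; have := cr l; rewrite /= !ffunE !inE; have [->|lj] /= := eqVneq l j.
    by rewrite ?eqxx jc /=; lia.
  by rewrite addr0.
move=> l; have := cr l; rewrite /= !inE; have [->|lj] //= := eqVneq l j.
by rewrite ?eqxx jc /=; lia.
Qed.

Lemma dual_Lambda_faces i n e :
  dual_Lambda R d i n e -> faces_in (dual_Lambda R d i n) e.
Proof.
move=> /dual_LambdaE[di cr] j jc.
have dj : (#|dirs e :\ j|%SET <= d - i)%N.
  by move: di; rewrite (dim_face jc) => /ltnW.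
split; apply/dual_LambdaE; split=> //.
  move=> l; have := cr l; rewrite /= !ffunE !inE; have [->|lj] /= := eqVneq l j.
    by rewrite ?eqxx jc /=; lia.
  by rewrite addr0.
move=> l; have := cr l; rewrite /= !inE; have [->|lj] //= := eqVneq l j.
by rewrite ?eqxx jc /=; lia.
Qed.

Lemma finite_box (n : nat) (X : set (cell d)) :
  (forall c, X c -> forall j, - n%:Z <= corner c j <= n%:Z) -> finite_set X.
Proof.
move=> Xn.
pose mk (u : {ffun 'I_d -> 'I_(n + n).+1} * {set 'I_d}) : cell d :=
  ([ffun j => (u.1 j : nat)%:Z - n%:Z], u.2).
apply: (sub_finite_set _ (finite_image mk (@finite_finset _ setT))) => c Xc.
exists ([ffun j => inord (absz (corner c j + n%:Z)%R)], dirs c) => //.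
apply: cellP => //= j; rewrite !ffunE /= inordK; have := Xn _ Xc j; lia.
Qed.

Lemma finite_Lambda i n : finite_set (Lambda R d i n).
Proof.
apply: (@finite_box n) => c /LambdaE[_ cr _] j; have := cr j.
by case: (j \in dirs c) => /=; lia.
Qed.

Lemma finite_dual_Lambda i n : finite_set (dual_Lambda R d i n).
Proof.
apply: (@finite_box n) => c /dual_LambdaE[_ cr] j; have := cr j.
by case: (j \in dirs c) => /=; lia.
Qed.

Fact dual_plaq_subproof k (c : kcell d k) : dim (dualc (val c)) == (d - k)%N.
Proof. by rewrite dim_dualc val_dim. Qed.

Definition dual_plaq k (c : kcell d k) : kcell d (d - k) :=
  exist _ (dualc (val c)) (dual_plaq_subproof c).

Fact undual_plaq_subproof k (kd : (k <= d)%N) (e : kcell d (d - k)) :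
  dim (undualc (val e)) == k.
Proof. by rewrite dim_undualc val_dim subKn. Qed.

Definition undual_plaq k (kd : (k <= d)%N) (e : kcell d (d - k)) : kcell d k :=
  exist _ (undualc (val e)) (undual_plaq_subproof kd e).

Lemma dual_plaqK k (kd : (k <= d)%N) : cancel (@dual_plaq k) (undual_plaq kd).
Proof. by move=> c; apply: val_inj; rewrite /= dualcK. Qed.

Lemma undual_plaqK k (kd : (k <= d)%N) : cancel (undual_plaq kd) (@dual_plaq k).
Proof. by move=> c; apply: val_inj; rewrite /= undualcK. Qed.

(** In a direction absent from [c] a common point has an integer coordinate, while the vertices of
    the dual lattice have half-integer ones. So [e] extends in that direction, and its corner there
    is determined. *)
Lemma dual_cellsE k (c : kcell d k) (e : kcell d (d - k)) :
  dual_cells R c e <-> e = dual_plaq c.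
Proof.
have kd : (k <= d)%N by rewrite -(val_dim c) dim_le.
have ltz (a b : int) : (a%:~R < b%:~R :> R) = (a < b) by rewrite ltr_int.
split=> [[y [yc ye]]|->].
  have out j : j \notin dirs (val c) ->
      j \in dirs (val e) /\ corner (val e) j = corner (val c) j - 1.
    move=> jc; have := yc j; have := ye j; rewrite (negPf jc) !addr0 -eq_le.
    move=> /[swap] /eqP <-; case: (boolP (j \in dirs (val e))) => je /=.
      move=> /andP[h1 h2]; split=> //.
      have {h1} : (corner (val e) j)%:~R < (corner (val c) j)%:~R :> R by lra.
      have {h2} : (corner (val c) j)%:~R < (corner (val e) j + 2)%:~R :> R.
        by rewrite intrD; lra.
      by rewrite !ltz /=; lia.
    move=> /andP[h1 h2]; exfalso.
    have {h1} : (corner (val e) j)%:~R < (corner (val c) j)%:~R :> R by lra.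
    have {h2} : (corner (val c) j)%:~R < (corner (val e) j + 1)%:~R :> R.
      by rewrite intrD; lra.
    by rewrite !ltz /=; lia.
  (* The inclusion just found is an equality because both sides have [d - k] elements. *)
  have eI : (~: dirs (val c) = dirs (val e))%SET.
    apply/eqP; rewrite eqEcard; apply/andP; split.
      by apply/fintype.subsetP => j; rewrite inE => /out[].
    rewrite -[X in (X <= _)%N]/(dim (val e)).
    by rewrite -[X in (_ <= X)%N]/(dim (dualc (val c))) dim_dualc !val_dim.
  apply: val_inj; apply: cellP => //= j; rewrite ffunE.
  case: (boolP (j \in dirs (val c))) => jc /=; last by have [] := out j jc.
  have := yc j; have := ye j; rewrite -eI inE jc /= !addr0 -eq_le => /eqP <-.
  move=> /andP[h1 h2].
  have {h1} : (corner (val c) j)%:~R < (corner (val e) j + 1)%:~R :> R.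
    by rewrite intrD; lra.
  have {h2} : (corner (val e) j)%:~R < (corner (val c) j + 1)%:~R :> R.
    by rewrite intrD; lra.
  by rewrite !ltz /= ?subr0; lia.
(* A cell and its dual share their centre. *)
exists (\row_j ((corner (val c) j)%:~R + (j \in dirs (val c))%:R / 2)); split=> j.
  by rewrite mxE addr0; case: (j \in dirs (val c)) => /=; apply/andP; lra.
rewrite mxE /= ffunE inE rmorphB /=.
by case: (j \in dirs (val c)) => /=; apply/andP; lra.
Qed.

Lemma dual_plaquettesE k (kd : (k <= d)%N) (S : set (kcell d k))
    (e : kcell d (d - k)) :
  dual_plaquettes R S e <-> ~ S (undual_plaq kd e).
Proof.
split=> [[c nSc /dual_cellsE ->]|nS]; first by rewrite dual_plaqK.
by exists (undual_plaq kd e) => //; apply/dual_cellsE; rewrite undual_plaqK.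
Qed.

Lemma dual_configE k (kd : (k <= d)%N) (w : config d k) (e : kcell d (d - k)) :
  dual_config R w e = ~~ w (undual_plaq kd e).
Proof.
rewrite /dual_config; apply/idP/idP.
  by move=> /set_mem /(dual_plaquettesE kd) /= /negP.
by move=> we; apply/mem_set/(dual_plaquettesE kd) => /=; apply/negP.
Qed.

End Boxes.

(** * Finite-volume duality *)

Section FiniteVolume.
Variables (R : realType) (d : nat).

Definition dual_open k (F A : {fset kcell d k}) : {fset kcell d (d - k)} :=
  [fset dual_plaq c | c in (F `\` A)%fset]%fset.

Lemma dual_plaq_inj k : injective (@dual_plaq d k).
Proof.
by move=> c c' /(congr1 val) /= /(can_inj (@dualcK d)) /val_inj.
Qed.

Lemma mem_dual_open k (F A : {fset kcell d k}) c :
  (dual_plaq c \in dual_open F A) = (c \in F) && (c \notin A).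
Proof.
by rewrite /dual_open (mem_imfset _ _ (@dual_plaq_inj k)) /= !inE andbC.
Qed.

Lemma card_dual_open k (F A : {fset kcell d k}) : (A `<=` F)%fset ->
  #|` dual_open F A| = (#|` F| - #|` A|)%N.
Proof.
by move=> AF; rewrite card_imfset /= ?cardfsDS //; exact: dual_plaq_inj.
Qed.

Lemma plaquettesE k (X : set (cell d)) (c : kcell d k) : finite_set X ->
  (c \in plaquettes k X) = (val c \in X).
Proof.
move=> Xf; rewrite /plaquettes in_fset_set.
  by apply/idP/idP; rewrite !inE.
exact: (finite_preimage (in2W val_inj)).
Qed.

Lemma plaquettes_dual_Lambda k n : (k <= d)%N ->
  plaquettes (d - k) (dual_Lambda R d k n) =
  dual_open (plaquettes k (Lambda R d k n)) fset0.
Proof.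
move=> kd; apply/fsetP => e; rewrite -(undual_plaqK kd e) mem_dual_open inE andbT.
rewrite !plaquettesE; [|exact: finite_dual_Lambda|exact: finite_Lambda].
apply/idP/idP => /set_mem h; apply/mem_set; move: h;
  by move=> /(dual_Lambda_dualc R n kd (val_dim (undual_plaq kd e))).
Qed.

(** Inside the box a dual plaquette is present when its primal plaquette is not in [A], outside when
    it is not in [xi]; the skeleton has too small a dimension to contribute. *)
Lemma bc_complex_dual k n (xi : set (kcell d k.+1)) (A : {fset kcell d k.+1}) c :
  (k.+1 < d)%N -> (A `<=` plaquettes k.+1 (Lambda R d k.+1 n))%fset ->
  dim c = k.+1 ->
  bc_complex (dual_Lambda R d k.+1 n) (dual_plaquettes R xi)
     (dual_open (plaquettes k.+1 (Lambda R d k.+1 n)) A) (dualc c) <->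
  ~ open_cells (Lambda R d k.+1 n) xi A c.
Proof.
move=> kd AF dc; set F := plaquettes _ _ in AF *; set L := Lambda _ _ _ _ in F AF *.
have kd' := ltnW kd.
pose c' : kcell d k.+1 := exist _ c (introT eqP dc).
have Lf : finite_set L by exact: finite_Lambda.
have openE : open_cells L xi A c <-> c' \in A \/ xi c' /\ ~ L c.
  split=> [[e eO ec]|c'O]; last by exists c'.
  have <- : e = c' by exact: val_inj.
  by rewrite -ec.
have nskel X : ~ @skeleton d (d - k.+1).-1 X (dualc c).
  by move=> [_]; rewrite dim_dualc dc; lia.
have AL : c' \in A -> L c.
  by move=> /(fsubsetP AF); rewrite plaquettesE // => /set_mem.
have L'E : dual_Lambda R d k.+1 n (dualc c) <-> L c by exact: dual_Lambda_dualc.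
split.
  move=> [[[/nskel//|[e /= eA ec]]|[e [exi eL] ec]]|/nskel//].
    have ee : e = dual_plaq c' by exact: val_inj.
    move: eA; rewrite ee mem_dual_open => /andP[cF cA] /openE[cA'|[_]].
      by rewrite cA' in cA.
    by apply; move: cF; rewrite plaquettesE // => /set_mem.
  have ee : e = dual_plaq c' by exact: val_inj.
  move: exi; rewrite ee => /(dual_plaquettesE R kd'); rewrite dual_plaqK => nxi.
  by move=> /openE[/AL /L'E|[]//]; rewrite -ec.
move=> nO; left; have [Lc|nLc] := pselect (L c).
  left; right; exists (dual_plaq c') => //=; rewrite mem_dual_open plaquettesE //.
  rewrite mem_set //=; apply/negP => cA; apply: nO; apply/openE; by left.
right; exists (dual_plaq c') => //; split; last by move=> /L'E.
apply/(dual_plaquettesE R kd'); rewrite dual_plaqK => xic.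
by apply: nO; apply/openE; right.
Qed.

Lemma card_im_duality k q n (xi : set (kcell d k.+1)) : (k.+1 < d)%N -> (1 < q)%N ->
  exists a b : nat, [/\ (0 < a)%N, (0 < b)%N &
  forall A, let L := Lambda R d k.+1 n in let L' := dual_Lambda R d k.+1 n in
    let F := plaquettes k.+1 L in (A `<=` F)%fset ->
    (#|` fset_set (im_coh q (perc_complex L A) (bc_complex L xi A) k)| * a =
     #|` fset_set (im_homBM q (perc_complex L' (dual_open F A))
         (bc_complex L' (dual_plaquettes R xi) (dual_open F A)) (d - k.+1).-1)| *
     (q ^ (#|` F| - #|` A|) * b))%N].
Proof.
move=> kd q1; set L := Lambda R d k.+1 n; set L' := dual_Lambda R d k.+1 n.
set F := plaquettes k.+1 L; pose m := (d - k.+1).-1.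
have dkm : (d - k.+1 = m.+1)%N by rewrite /m; lia.
have Lf : finite_set L by exact: finite_Lambda.
have L'f : finite_set L' by exact: finite_dual_Lambda.
have Lcl : face_closed k L by move=> c _; exact: Lambda_faces.
pose cB := #|` fset_set (@coboundaries d q L k)|.
pose cZ := #|` fset_set (@cyclesBM d q L' m)|.
pose cR A := #|` fset_set (Ropen q k L (open_cells L xi A))|.
pose cW A := #|` fset_set (Wopen q k m L' (open_cells L xi A))|.
have cR0 A : (0 < cR A)%N.
  apply: (@fset_set_gt0 _ _ 0); first exact: finite_Ropen.
  by apply: coboundaries_Ropen; have [] := subgroup_coboundaries q L k.
have cW0 A : (0 < cW A)%N.
  apply: (@fset_set_gt0 _ _ 0); last exact: Wopen0.
  exact: finite_setIl (finite_cyclesBM _ _ _).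
(* The factors that do not depend on [A]: coboundaries and cycles of the boxes on one side, the
   fully open configuration on the other. Keeping them apart avoids division in the naturals. *)
exists (cB * cZ)%N, (cR F * cW F)%N; split.
- rewrite muln_gt0; apply/andP; split.
    apply: (@fset_set_gt0 _ _ 0); last by have [] := subgroup_coboundaries q L k.
    apply: sub_finite_set (finite_Ropen q k set0 Lf); exact: coboundaries_Ropen.
  apply: (@fset_set_gt0 _ _ 0); first exact: finite_cyclesBM.
  exact: cyclesBM0.
- by rewrite muln_gt0 cR0 cW0.
move=> A /= AF; set c := #|` _|; set b := #|` _|.
have HR : cR A = (c * cB)%N by exact: card_im_coh.
have HZ : cZ = (b * cW A)%N.
  apply: card_im_homBM => // e de; exact: bc_complex_dual.
have HT : (cR A * cW A = q ^ (#|` F| - #|` A|) * (cR F * cW F))%N.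
  apply: card_Ropen_Wopen => // e Le de; split; first exact: Lambda_faces.
  by apply: dual_Lambda_faces; apply/dual_Lambda_dualc => //; exact: ltnW.
by rewrite -HT HR HZ mulnA -HR; ring.
Qed.

Lemma dual_param_denom (p : R) q : 0 <= p <= 1 -> (1 < q)%N ->
  0 < (1 - p) * q%:R + p.
Proof.
move=> /andP[p0 p1] q1; have q2 : 2 <= q%:R :> R by rewrite (ler_nat _ 2).
by nra.
Qed.

(** With [D = (1 - p) q + p], the dual parameter is [(1 - p) q / D] and its complement is [p / D].
    The dual has as many open plaquettes as [A] leaves closed, so the powers of [q] cancel those in
    [card_im_duality]. *)
Lemma weight_dual k q n (p : R) (xi : set (kcell d k.+1)) :
    (k.+1 < d)%N -> (1 < q)%N -> 0 <= p <= 1 ->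
  exists2 K : R, K != 0 & forall A,
    (A `<=` plaquettes k.+1 (Lambda R d k.+1 n))%fset ->
    weight_BM (dual_param p q) q (dual_Lambda R d k.+1 n) (dual_plaquettes R xi)
      (dual_open (plaquettes k.+1 (Lambda R d k.+1 n)) A) =
    K * weight_coh p q (Lambda R d k.+1 n) xi A.
Proof.
move=> kd q1 p01; have [a [b [a0 b0 ab]]] := @card_im_duality k q n xi kd q1.
have D0 := dual_param_denom p01 q1; set D := (1 - p) * q%:R + p in D0 *.
set F := plaquettes _ _; pose N := #|` F|.
have Dn : D != 0 by rewrite gt_eqF.
have an : a%:R != 0 :> R by rewrite pnatr_eq0 -lt0n.
have bn : b%:R != 0 :> R by rewrite pnatr_eq0 -lt0n.
have qn : q%:R != 0 :> R by rewrite pnatr_eq0 -lt0n ltnW.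
exists (D ^- N * (a%:R / b%:R)).
  by rewrite mulf_neq0 ?mulf_neq0 ?invr_eq0 ?expf_neq0.
move=> A AF; have := ab A AF; rewrite /weight_BM /weight_coh /bernoulli_weight.
set c := #|` _|; set e := #|` _|; move=> /(congr1 (fun n : nat => n%:R : R)).
rewrite plaquettes_dual_Lambda ?(ltnW kd) // !card_dual_open ?fsub0set //.
rewrite cardfs0 subn0 -/F -/N.
have AN : (#|` A| <= N)%N by exact: fsubset_leq_card.
rewrite subKn //; move: (#|` A|) AN => x xN; rewrite !natrM natrX => ceq.
have -> : dual_param p q = ((1 - p) * q%:R) / D by [].
have -> : 1 - (1 - p) * q%:R / D = p / D by rewrite /D; field.
have eE : e%:R = c%:R * a%:R / (q%:R ^+ (N - x) * b%:R) :> R.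
  by apply: (canRL (mulfK _)); rewrite ?ceq ?mulf_neq0 ?expf_neq0.
have DN : D ^+ N = D ^+ (N - x) * D ^+ x by rewrite -exprD subnK.
rewrite eE !exprMn !exprVn DN.
(* The powers become variables for [field]; only those of [q] and [D] are known to be nonzero, as
   [p] may be 0 or 1. *)
move: (expf_neq0 (N - x) qn) (expf_neq0 (N - x) Dn) (expf_neq0 x Dn).
move: (q%:R ^+ (N - x)) (D ^+ (N - x)) (D ^+ x) ((1 - p) ^+ (N - x)) (p ^+ x).
move=> Q D1 D2 r s Q0 D10 D20; field.
by rewrite Q0 bn D10 D20.
Qed.

(** Taking duals of closed plaquettes is a bijection between the configurations of the two boxes,
    and the constant of [weight_dual] cancels in the normalised ratio. *)
Lemma gibbs_dual k q n (p : R) (xi : set (kcell d k.+1))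
    (E : set (config d (d - k.+1))) (F0 : {fset kcell d (d - k.+1)})
    (kd : (k.+1 <= d)%N) :
    (k.+1 < d)%N -> (1 < q)%N -> 0 <= p <= 1 ->
    (forall w w' : config d (d - k.+1),
       (forall c, c \in F0 -> w c = w' c) -> E w -> E w') ->
    (forall e, e \in F0 -> Lambda R d k.+1 n (val (undual_plaq kd e))) ->
  mu_BM (dual_param p q) q (dual_Lambda R d k.+1 n) (dual_plaquettes R xi) E =
  mu_coh p q (Lambda R d k.+1 n) xi (dual_config R @^-1` E).
Proof.
move=> kd1 q1 p01 EF F0L; have [K K0 wK] := @weight_dual k q n p xi kd1 q1 p01.
have Lf : finite_set (Lambda R d k.+1 n) by exact: finite_Lambda.
rewrite /mu_BM /mu_coh /gibbs plaquettes_dual_Lambda //.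
set F := plaquettes _ _ in wK *.
have dFE : fpowerset (dual_open F fset0) =
    [fset dual_open F A | A in fpowerset F]%fset.
  apply/fsetP => B; rewrite fpowersetE; apply/idP/imfsetP => /=.
    move=> BF; exists [fset c in F | dual_plaq c \notin B]%fset.
      by rewrite fpowersetE; apply/fsubsetP => c; rewrite !inE => /andP[].
    apply/fsetP => e; rewrite -(undual_plaqK kd e) mem_dual_open !inE.
    case: (boolP (_ \in B)) => [eB|]; last by rewrite andbT; case: (_ \in F).
    have := fsubsetP BF _ eB; rewrite mem_dual_open inE andbT => ->.
    by rewrite andbF.
  move=> [A _ ->]; apply/fsubsetP => e; rewrite -(undual_plaqK kd e).
  by rewrite !mem_dual_open inE andbT => /andP[].
have inj : {in fpowerset F &, injective (dual_open F)}.
  move=> A B; rewrite !fpowersetE => AF BF AB; apply/fsetP => c.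
  have := congr1 (fun S : {fset _} => dual_plaq c \in S) AB.
  rewrite /= !mem_dual_open; have [cF /= /negb_inj //|cF _] := boolP (c \in F).
  rewrite (contraNF (fsubsetP AF c)) //; exact/esym/contraNF/cF/(fsubsetP BF c).
have sumE (P : pred {fset kcell d (d - k.+1)}) (w : {fset kcell d (d - k.+1)} -> R) :
    \sum_(B <- fpowerset (dual_open F fset0) | P B) w B =
    \sum_(A <- fpowerset F | P (dual_open F A)) w (dual_open F A).
  by rewrite dFE big_mkcond big_imfset //= -big_mkcond.
rewrite !sumE.
have KE (P : pred {fset kcell d k.+1}) :
    \sum_(A <- fpowerset F | P A) weight_BM (dual_param p q) q
      (dual_Lambda R d k.+1 n) (dual_plaquettes R xi) (dual_open F A) =
    K * \sum_(A <- fpowerset F | P A) weight_coh p q (Lambda R d k.+1 n) xi A.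
  rewrite mulr_sumr big_seq_cond [RHS]big_seq_cond; apply: eq_bigr => A.
  by move=> /andP[]; rewrite fpowersetE => AF _; exact: wK.
rewrite !KE -mulf_div divff // mul1r; congr (_ / _).
rewrite big_seq_cond [RHS]big_seq_cond; apply: eq_bigl => A.
case: (boolP (A \in fpowerset F)) => //=; rewrite fpowersetE => AF.
(* The agreement is confined to the box: outside it [config_of] closes everything, so [dual_config]
   opens everything. The event reads only [F0], which lies inside. *)
have agree e : e \in F0 ->
    config_of (dual_open F A) e = dual_config R (config_of A) e.
  move=> eF; rewrite (dual_configE R kd) /config_of -{1}(undual_plaqK kd e).
  by rewrite mem_dual_open plaquettesE // mem_set //; exact: F0L.
by apply/idP/idP => /set_mem h; apply/mem_set; apply: EF h => e /agree.
Qed.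

End FiniteVolume.

(** * Infinite volume *)

Section Configurations.
Variables (R : realType) (d : nat).

Lemma Lambda_exhausts k (F : {fset kcell d k}) :
  \forall n \near \oo, forall c, c \in F -> Lambda R d k n (val c).
Proof.
pose M (c : kcell d k) : nat := (\max_j absz (corner (val c) j))%N.
(* The successor gives [|x| < n] for every corner coordinate, which leaves room for a unit edge and
   for the strict interior condition. *)
exists (\max_(c <- F) M c).+1%N => // n /= Fn c cF.
have cn j : (absz (corner (val c) j) < n)%N.
  apply: leq_trans Fn; rewrite ltnS.
  apply: (@leq_trans (M c)); last exact: leq_bigmax_seq.
  exact: (leq_bigmax j).
apply/LambdaE; split=> [|j|_ j jc]; first by rewrite val_dim.
  by have := cn j; case: (j \in _) => /=; lia.
by have := cn j => /=; lia.
Qed.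

Lemma measurable_coordinate k (c : kcell d k) :
  measurable ([set w | w c] : set (config d k)).
Proof. by apply: sub_sigma_algebra; exists c. Qed.

Lemma measurable_dual_config k : (k <= d)%N ->
  measurable_fun [set: config d k] (@dual_config R d k).
Proof.
move=> kd; apply: (@measurability _ _ (config d k) (config d (d - k)) _ _
  (@coordinate_events d (d - k))) => //.
move=> _ [_ [e _ <-] <-]; rewrite setTI.
have -> : @dual_config R d k @^-1` [set w | w e] =
    ~` [set w | w (undual_plaq kd e)].
  by apply/seteqP; split=> w /=; rewrite (dual_configE R kd) => /negP.
by apply: measurableC; exact: measurable_coordinate.
Qed.

(** The events that all plaquettes of a given finite set are open are finitely determined, stable
    under intersection, and generate the sigma-algebra, so uniqueness of measures on a pi-system
    applies. *)
Lemma probability_eq_finitely_determined k (mu nu : probability (config d k) R) :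
    (forall E : set (config d k), finitely_determined E -> mu E = nu E) ->
  forall A : set (config d k), measurable A -> mu A = nu A.
Proof.
move=> munu A mA.
pose G := [set E : set (config d k) |
  exists F : {fset kcell d k}, E = [set w | forall c, c \in F -> w c]].
apply: (@g_sigma_algebra_measure_unique _ R (config d k) G _ (fun=> setT)).
- move=> _ [F ->].
  rewrite [X in measurable X](_ : _ =
    \bigcap_(c in [set` F]) [set w : config d k | w c]) //.
  by apply: fin_bigcap_measurable => // c _; exact: measurable_coordinate.
- by move=> _; exists fset0; apply/seteqP; split=> // w _ c; rewrite inE.
- by rewrite bigcup_const //; exists 0%N.
- move=> _ _ [F ->] [F' ->]; exists (F `|` F')%fset; apply/seteqP; split=> w /=.
    by move=> [wF wF'] c; rewrite inE => /orP[/wF|/wF'].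
  by move=> wFF'; split=> c cF; apply: wFF'; rewrite inE cF ?orbT.
- move=> _ [F ->]; apply: munu; exists F => w w' ww' wF c cF.
  by rewrite -ww' //; exact: wF.
- by move=> _; rewrite /= probability_setT ltry.
- apply: (@smallest_sub _ _ _ _ _ _ A mA); first exact: smallest_sigma_algebra.
  move=> _ [c _ <-]; apply: sub_sigma_algebra; exists [fset c]%fset.
  apply/seteqP; split=> w /=; first by move=> wc e; rewrite inE => /eqP ->.
  by apply; rewrite inE.
Qed.

Lemma finitely_determined_dual k (E : set (config d (d - k))) : (k <= d)%N ->
  finitely_determined E -> finitely_determined (@dual_config R d k @^-1` E).
Proof.
move=> kd [F EF]; exists [fset undual_plaq kd e | e in F]%fset => w w' ww'.
apply: EF => e eF; rewrite !(dual_configE R kd) ww' //.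
by apply/imfsetP; exists e.
Qed.

End Configurations.

Theorem theorem20 (R : realType) (d i q : nat) (p : R)
    (hd : (2 <= d)%N) (hi : (1 <= i <= d - 1)%N) (hq : (2 <= q)%N)
    (hp : 0 <= p <= 1) (xi : set (kcell d i))
    (mu : probability (config d i) R)
    (hmu : weak_limit (fun n => mu_coh p q (Lambda R d i n) xi) mu) :
  let nu_ n := mu_BM (dual_param p q) q (dual_Lambda R d i n)
                     (dual_plaquettes R xi) in
  (exists nu : probability (config d (d - i)) R, weak_limit nu_ nu) /\
  (forall nu : probability (config d (d - i)) R, weak_limit nu_ nu ->
     forall A : set (config d (d - i)), measurable A ->
       pushforward mu (dual_config R) A = nu A).
Proof.
case: i hi xi mu hmu => // k hi xi mu hmu nu_.
have kd1 : (k.+1 < d)%N by lia.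
have kd := ltnW kd1.
pose X : {mfun config d k.+1 >-> config d (d - k.+1)} :=
  mfun_Sub (mem_set (measurable_dual_config R kd)).
(* The candidate limit is the law of the dual complex under [mu]. *)
pose nu0 : probability (config d (d - k.+1)) R := distribution mu X.
have nu0E A : nu0 A = mu (dual_config R @^-1` A) by [].
have lim0 : weak_limit nu_ nu0.
  move=> E Efd; rewrite nu0E.
  have := hmu _ (finitely_determined_dual R kd Efd).
  apply: cvg_trans; apply: near_eq_cvg.
  case: Efd => F EF.
  (* Once the box contains the primal plaquettes of those on which [E] depends, the two
     finite-volume probabilities are equal, so the sequences share their limit. *)
  have := @Lambda_exhausts R d k.+1 [fset undual_plaq kd e | e in F]%fset.
  apply: filterS => n Fn; congr (_%:E); apply/esym; apply: gibbs_dual EF _ => //.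
  by move=> e eF; apply: Fn; apply/imfsetP; exists e.
split=> [|nu hnu A mA]; first by exists nu0.
(* Any other weak limit agrees with [nu0] on finitely determined events by uniqueness of limits. *)
apply: (probability_eq_finitely_determined _ mA (mu := nu0)) => E Efd.
exact: cvg_unique (lim0 E Efd) (hnu E Efd).
Qed.
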